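(* In the Glosten--Milgrom model described in the context (order size $\delta>0$, noise intensity $\beta>0$, fundamental value $\tilde v\in\{0,1\}$ with $\mathbb P(\tilde v=0)\in(0,1)$), let $p:\delta\mathbb Z\times[0,1]\to[0,1]$, let $X^B,X^S$ be processes and $\mathcal F^I$ a filtration, and put $X=X^B-X^S$, $Y=Z+X$. Then $(p,X^B,X^S,\mathcal F^I)$ is a Glosten--Milgrom equilibrium if there exists $y_\delta\in\delta\mathbb Z$ such that (i) $[Y_1\ge y_\delta]=[\tilde v=1]$, $\mathbb P$-a.s.; (ii) $p=p^{y_\delta}$, where $p^{z}(y,t):=\mathbb P(Z_1\ge z\mid Z_t=y)$ for $z,y\in\delta\mathbb Z$, $t\in[0,1]$; (iii) $(X^B,X^S;\mathcal F^I)$ is an admissible strategy such that $Y=Z+X^B-X^S=Y^B-Y^S$, where $Y^B/\delta$ and $Y^S/\delta$ are independent, $\mathcal F^Y$-adapted Poisson processes with common intensity $\beta$, and $X^S\equiv 0$ on $[\tilde v=1]$, $X^B\equiv 0$ on $[\tilde v=0]$.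
   Context: Model. All objects live on a filtered probability space $(\Omega,\mathcal F,(\mathcal F_t)_{t\in[0,1]},\mathbb P)$ satisfying the usual conditions. $\tilde v$ takes values in $\{0,1\}$ with $\mathbb P(\tilde v=0)\in(0,1)$. The noise traders' net demand is $Z=Z^B-Z^S$, where $Z^B/\delta$ and $Z^S/\delta$ are independent Poisson processes with constant intensity $\beta$ (so $Z_0=0$), independent of $\tilde v$. $\mathcal F^Z$ is the filtration generated by $Z$. The insider's net order is $X=X^B-X^S$ (cumulative buys minus cumulative sells), total demand is $Y=Z+X$, and $(\mathcal F^Y_t)$ is the minimal filtration generated by $Y$ satisfying the usual conditions. Pricing rule. A function $p:\delta\mathbb Z\times[0,1]\to[0,1]$ is a pricing rule if $y\mapsto p(y,t)$ is strictly increasing for each $t\in[0,1)$ and $t\mapsto p(y,t)$ is continuously differentiable for each $y\in\delta\mathbb Z$. Admissible strategy. $(X^B,X^S;\mathcal F^I)$ is admissible if: (i) $\mathcal F^I$ is a filtration satisfying the usual conditions such that $\mathcal F^I_t=\sigma(\tilde v,\mathcal F^Z_t,\mathcal H_t)$, where $\mathcal H$ is a filtration independent of $\tilde v$ and $\mathcal F^Z$; (ii) $X^B,X^S$, with $X^B_0=X^S_0=0$, are $\mathcal F^I$-adapted increasing point processes with jump size $\delta$ and $\mathbb E[X^B_1],\mathbb E[X^S_1]<\infty$; (iii) the $(\mathcal F^I,\mathbb P)$-dual predictable projections (predictable compensators) of $X^B$ and $X^S$ are absolutely continuous functions of time. It is assumed without loss of generality that the insider never places a buy and a sell order at the same time.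 Decomposition. $X^B=X^{B,B}+X^{B,T}+X^{B,S}$, where $X^{B,B}$ collects buy orders arriving at times different from the jump times of the noise orders, $X^{B,T}$ buy orders arriving at jump times of $Z^B$, and $X^{B,S}$ buy orders arriving at jump times of $Z^S$ (cancelling noise sells). Similarly $X^S=X^{S,S}+X^{S,T}+X^{S,B}$, with the roles of buy and sell exchanged. Expected profit. Given a pricing rule $p$, the insider's expected profit is $$\mathbb E\Big[\int_0^1(\tilde v-p(Y_{t-}+\delta,t))\,dX^{B,B}_t+\int_0^1(\tilde v-p(Y_{t-}+2\delta,t))\,dX^{B,T}_t+\int_0^1(\tilde v-p(Y_{t-},t))\,dX^{B,S}_t$$ $$-\int_0^1(\tilde v-p(Y_{t-}-\delta,t))\,dX^{S,S}_t-\int_0^1(\tilde v-p(Y_{t-}-2\delta,t))\,dX^{S,T}_t-\int_0^1(\tilde v-p(Y_{t-},t))\,dX^{S,B}_t\,\Big|\,\tilde v\Big].$$ Equilibrium. $(p,X^B,X^S,\mathcal F^I)$ is a Glosten--Milgrom equilibrium if (i) given $(X^B,X^S;\mathcal F^I)$, $p$ is a rational pricing rule, i.e. a pricing rule with $p(Y_t,t)=\mathbb E[\tilde v\mid\mathcal F^Y_t]$ for $t\in[0,1]$; (ii) given $p$, $(X^B,X^S;\mathcal F^I)$ is an admissible strategy maximising the expected profit above. *)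

(* Defs.v *)
From HB Require Import structures.
From mathcomp Require Import all_boot all_order all_algebra.
From mathcomp Require Import all_classical all_reals all_analysis.

Set Implicit Arguments.
Unset Strict Implicit.
Unset Printing Implicit Defensive.

Import Order.TTheory GRing.Theory Num.Theory.
Import numFieldNormedType.Exports.

Local Open Scope classical_set_scope.
Local Open Scope ring_scope.

(* Processes and filtrations are indexed by R, prices are functions on R * R;
   only their restrictions to [0, 1], resp. to delta Z * [0, 1], are ever
   constrained or used. Sigma-algebras are set systems on the sample space. *)

Section Paths.
Context {R : realType}.
Implicit Types (x h f : R -> R) (t : R).

Definition left_lim x t : R := lim (x s @[s --> t^'-]).

Definition jump x t : R := x t - left_lim x t.

(* Path on [0, 1] of an increasing point process with jumps of size c. *)
Record point_path (c : R) x : Prop := PointPath {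
  point_path0 : x 0 = 0 ;
  point_path_nondecreasing :
    forall s t, 0 <= s -> s <= t -> t <= 1 -> x s <= x t ;
  point_path_right_continuous :
    forall t, 0 <= t < 1 -> x s @[s --> t^'+] --> x t ;
  point_path_lattice : forall t, 0 <= t <= 1 -> exists n : nat, x t = c *+ n ;
  point_path_jump : forall t, 0 < t <= 1 -> jump x t = 0 \/ jump x t = c }.

(* The integral of h over ]0, 1] against dx, for a path x that is piecewise
   constant with finitely many jumps; \sum_(t \in _) sums over the finite
   support of the summand. *)
Definition point_integral h x : R :=
  \sum_(t \in `]0%R, 1%R]%classic) h t * jump x t.

(* The part of the point path x made of its jumps at times in D. *)
Definition jumps_in (D : set R) x : R -> R :=
  fun t => \sum_(s \in `]0, t]%classic `&` D) jump x s.

Definition jump_times x : set R := [set t | jump x t != 0].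

(* Differentiability is relative to [0, 1], hence one-sided at 0 and 1. *)
Definition C1_on01 f : Prop :=
  exists2 f' : R -> R, {within `[0, 1], continuous f'} &
    forall t, 0 <= t <= 1 ->
      (f s - f t) / (s - t) @[s --> within `[0, 1]%classic t^'] --> f' t.

Definition abs_continuous01 f : Prop :=
  forall e : R, 0 < e -> exists2 eta : R, 0 < eta &
    forall (n : nat) (a b : nat -> R),
      (forall i, (i < n)%N -> [/\ 0 <= a i, a i <= b i & b i <= 1]) ->
      trivIset `I_n (fun i => `]a i, b i[%classic) ->
      \sum_(i < n) (b i - a i) < eta ->
      \sum_(i < n) `|f (b i) - f (a i)| < e.

End Paths.

Section Filtrations.
Context {R : realType} {d : measure_display} {T : measurableType d}.
Variable P : probability T R.
Implicit Types (G H : set (set T)) (F : R -> set (set T)) (X : R -> T -> R).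

Definition sigma_rv (V : T -> R) : set (set T) :=
  preimage_set_system setT V measurable.

Definition natural_filtration X : R -> set (set T) :=
  fun t => <<s \bigcup_(s in `[0, t]) sigma_rv (X s) >>.

Definition indep G H : Prop :=
  forall A B, G A -> H B -> P (A `&` B) = (P A * P B)%E.

Record filtration F : Prop := Filtration {
  filtration_sigma_algebra :
    forall t, 0 <= t <= 1 -> sigma_algebra setT (F t) ;
  filtration_measurable : forall t, 0 <= t <= 1 -> F t `<=` measurable ;
  filtration_mono :
    forall s t, 0 <= s -> s <= t -> t <= 1 -> F s `<=` F t }.

Record usual_filtration F : Prop := UsualFiltration {
  usual_is_filtration : filtration F ;
  usual_complete : P.-negligible `<=` F 0 ;
  usual_right_continuous :
    forall t, 0 <= t < 1 -> \bigcap_(s in `]t, 1]) F s `<=` F t }.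

Definition adapted F X : Prop :=
  forall t, 0 <= t <= 1 -> sigma_rv (X t) `<=` F t.

(* The least filtration satisfying the usual conditions that X is adapted to. *)
Definition minimal_filtration X : R -> set (set T) :=
  fun t => [set A | forall F, usual_filtration F -> adapted F X -> F t A].

Record is_cond_exp G (V W : T -> R) : Prop := IsCondExp {
  cond_exp_integrable : P.-integrable setT (EFin \o V) ;
  cond_exp_integrable_version : P.-integrable setT (EFin \o W) ;
  cond_exp_measurable : sigma_rv W `<=` G ;
  cond_exp_eq : forall A, G A ->
    (\int[P]_(w in A) (W w)%:E = \int[P]_(w in A) (V w)%:E)%E }.

Definition martingale F X : Prop :=
  adapted F X /\
  forall s t, 0 <= s -> s <= t -> t <= 1 -> is_cond_exp (F s) (X t) (X s).

Definition predictable_sigma F : set (set (R * T)) :=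
  <<s `[0, 1]%classic `*` setT,
      [set E | exists2 A, F 0 A & E = [set 0] `*` A] `|`
      [set E | exists s t A, [/\ 0 <= s, s < t, t <= 1, F s A &
                                 E = `]s, t]%classic `*` A]] >>.

Definition predictable F X : Prop :=
  forall B : set R, measurable B ->
    predictable_sigma F [set z | 0 <= z.1 <= 1 /\ B (X z.1 z.2)].

(* For an integrable increasing process X, the dual predictable projection is
   the unique predictable increasing A with A_0 = 0 and X - A a martingale. *)
Record compensator F X (A : R -> T -> R) : Prop := Compensator {
  compensator_predictable : predictable F A ;
  compensator_path : {ae P, forall w, [/\ A 0 w = 0,
    (forall s t, 0 <= s -> s <= t -> t <= 1 -> A s w <= A t w) &
    (forall t, 0 <= t < 1 -> A s w @[s --> t^'+] --> A t w)]} ;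
  compensator_martingale : martingale F (fun t w => X t w - A t w) }.

Definition has_abs_continuous_compensator F X : Prop :=
  exists2 A, compensator F X A & {ae P, forall w, abs_continuous01 (A ^~ w)}.

Record poisson_process (beta : R) (N : R -> T -> R) : Prop := PoissonProcess {
  poisson_measurable : forall t, 0 <= t <= 1 -> measurable_fun setT (N t) ;
  poisson_path : forall w, point_path 1 (N ^~ w) ;
  poisson_increment_law : forall s t (k : nat), 0 <= s -> s < t -> t <= 1 ->
    P [set w | N t w - N s w = k%:R] = (poisson_pmf (beta * (t - s)) k)%:E ;
  poisson_increment_indep : forall s t, 0 <= s -> s <= t -> t <= 1 ->
    indep (natural_filtration N s) (sigma_rv (fun w => N t w - N s w)) }.

End Filtrations.

Section Model.
Context {R : realType} {d : measure_display} {T : measurableType d}.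
Variables (P : probability T R) (delta beta : R).
Variables (v : T -> R) (ZB ZS : R -> T -> R).
Implicit Types (p : R -> R -> R) (XB XS : R -> T -> R) (FI : R -> set (set T)).

Definition grid : set R := [set y | exists k : int, y = k%:~R * delta].

Definition noise : R -> T -> R := fun t w => ZB t w - ZS t w.

Definition total_demand XB XS : R -> T -> R :=
  fun t w => noise t w + (XB t w - XS t w).

Record market (FF : R -> set (set T)) : Prop := Market {
  market_usual : usual_filtration P FF ;
  market_adapted : adapted FF ZB /\ adapted FF ZS ;
  market_value_measurable : measurable_fun setT v ;
  market_value : forall w, v w = 0 \/ v w = 1 ;
  market_value_prob : (0 < P [set w | v w = 0%R] < 1)%E ;
  market_poisson_buy : poisson_process P beta (fun t w => ZB t w / delta) ;
  market_poisson_sell : poisson_process P beta (fun t w => ZS t w / delta) ;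
  market_noise_indep :
    indep P (natural_filtration ZB 1) (natural_filtration ZS 1) ;
  market_value_indep : indep P (sigma_rv v)
    <<s natural_filtration ZB 1 `|` natural_filtration ZS 1 >> }.

Record pricing_rule p : Prop := PricingRule {
  pricing_range : forall y t, grid y -> 0 <= t <= 1 -> 0 <= p y t <= 1 ;
  pricing_increasing : forall y y' t, grid y -> grid y' -> 0 <= t < 1 ->
    y < y' -> p y t < p y' t ;
  pricing_C1 : forall y, grid y -> C1_on01 (p y) }.

Record admissible XB XS FI : Prop := Admissible {
  admissible_usual : usual_filtration P FI ;
  admissible_information : exists HH : R -> set (set T),
    [/\ filtration HH,
        (forall t, 0 <= t <= 1 -> indep P (HH t)
           <<s sigma_rv v `|` natural_filtration noise 1 >>) &
        (forall t, 0 <= t <= 1 -> FI t =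
           <<s sigma_rv v `|` natural_filtration noise t `|` HH t >>)] ;
  admissible_adapted : adapted FI XB /\ adapted FI XS ;
  admissible_path :
    forall w, point_path delta (XB ^~ w) /\ point_path delta (XS ^~ w) ;
  admissible_integrable : (('E_P[XB 1%R] < +oo) /\ ('E_P[XS 1%R] < +oo))%E ;
  admissible_compensator : has_abs_continuous_compensator P FI XB /\
    has_abs_continuous_compensator P FI XS ;
  admissible_no_simultaneous : {ae P, forall w, forall t, 0 < t <= 1 ->
    jump (XB ^~ w) t = 0 \/ jump (XS ^~ w) t = 0} }.

(* XBB, XSS: insider orders arriving alone; XBT, XST: arriving together with a
   noise order of the same side; XBS, XSB: cancelling an opposite noise order. *)
Section Profit.
Variables (p : R -> R -> R) (XB XS : R -> T -> R) (w : T).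

Let noise_buys := jump_times (ZB ^~ w).
Let noise_sells := jump_times (ZS ^~ w).

Definition XBB : R -> R := jumps_in (~` (noise_buys `|` noise_sells)) (XB ^~ w).
Definition XBT : R -> R := jumps_in noise_buys (XB ^~ w).
Definition XBS : R -> R := jumps_in noise_sells (XB ^~ w).
Definition XSS : R -> R := jumps_in (~` (noise_buys `|` noise_sells)) (XS ^~ w).
Definition XST : R -> R := jumps_in noise_sells (XS ^~ w).
Definition XSB : R -> R := jumps_in noise_buys (XS ^~ w).

Definition profit : R :=
  let Y_ t := left_lim ((total_demand XB XS) ^~ w) t in
  point_integral (fun t => v w - p (Y_ t + delta) t) XBB
  + point_integral (fun t => v w - p (Y_ t + 2 * delta) t) XBT
  + point_integral (fun t => v w - p (Y_ t) t) XBS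
  - point_integral (fun t => v w - p (Y_ t - delta) t) XSS
  - point_integral (fun t => v w - p (Y_ t - 2 * delta) t) XST
  - point_integral (fun t => v w - p (Y_ t) t) XSB.

End Profit.

Definition rational_pricing p XB XS : Prop :=
  let Y := total_demand XB XS in
  pricing_rule p /\
  forall t, 0 <= t <= 1 ->
    is_cond_exp P (minimal_filtration P Y t) v (fun w => p (Y t w) t).

(* Conditional expectations are only defined up to null sets, so profits are
   compared through versions of them; the existence of these versions is part
   of the claim. *)
Definition optimal_strategy p XB XS FI : Prop :=
  admissible XB XS FI /\
  exists2 W, is_cond_exp P (sigma_rv v) (profit p XB XS) W &
    forall XB' XS' FI', admissible XB' XS' FI' ->
      exists2 W', is_cond_exp P (sigma_rv v) (profit p XB' XS') W' &
        {ae P, forall w, W' w <= W w}.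

Definition GM_equilibrium p XB XS FI : Prop :=
  rational_pricing p XB XS /\ optimal_strategy p XB XS FI.

(* P(Z_1 >= z | Z_t = y). When [Z_t = y] is null (that is, t = 0 and y <> 0),
   the elementary quotient is undefined and the conditional probability is
   read through the transition function of the Markov process Z. *)
Definition bridge_price (z y t : R) : R :=
  let E := [set w | noise t w = y] in
  if P E == 0%E then fine (P [set w | z <= y + (noise 1 w - noise t w)])
  else fine (P ([set w | z <= noise 1 w] `&` E)) / fine (P E).

Record inconspicuous XB XS FI : Prop := Inconspicuous {
  inconspicuous_admissible : admissible XB XS FI ;
  inconspicuous_demand : let Y := total_demand XB XS in
    exists YB YS : R -> T -> R,
    [/\ {ae P, forall w, forall t, 0 <= t <= 1 -> Y t w = YB t w - YS t w},
        poisson_process P beta (fun t w => YB t w / delta) /\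
          poisson_process P beta (fun t w => YS t w / delta),
        indep P (natural_filtration YB 1) (natural_filtration YS 1) &
        adapted (minimal_filtration P Y) YB /\
          adapted (minimal_filtration P Y) YS] ;
  inconspicuous_no_sell : {ae P, forall w, v w = 1 ->
    forall t, 0 <= t <= 1 -> XS t w = 0} ;
  inconspicuous_no_buy : {ae P, forall w, v w = 0 ->
    forall t, 0 <= t <= 1 -> XB t w = 0} }.

End Model.

(* Main.v *)
(* Idea. Write Z for the noise and X for the insider's position. Along a path
   the profit is the sum of (v - p(Y_t, t)) dX_t over the jumps of X, because
   ZB and ZS almost surely have no common jump; it is the limit of right-endpoint
   Riemann sums over the grid k/n. As p(Y_t, t) = P(y + Z_1 - Z_t >= z) at
   y = Y_t and Z_1 - Z_t is independent of the insider's information at t, the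
   price may be replaced, in expectation on an event of sigma(v), by the
   indicator of Z_1 + X_t >= z. The resulting sum telescopes against a convex
   function: on [v = 1] it is at most (z - delta - Z_1)^+, on [v = 0] at most
   (Z_1 - z)^+, whatever the strategy. For the inconspicuous strategy X moves by
   single steps in one direction until Z_1 + X_1 is on the right side of z, so
   equality holds in the limit and dominated convergence gives optimality.

   Rationality of p holds because Y_1 - Y_t has the law of Z_1 - Z_t and is
   independent of a usual filtration to which Y is adapted, namely the
   right-continuous completed past of (YB, YS). *)

Require Import Defs.
From HB Require Import structures.
From mathcomp Require Import all_boot all_order all_algebra.
From mathcomp Require Import all_classical all_reals all_analysis.
From mathcomp Require Import measurable_realfun.
From mathcomp Require Import ring lra zify.

Set Implicit Arguments.
Unset Strict Implicit.
Unset Printing Implicit Defensive.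

Import Order.TTheory GRing.Theory Num.Theory.
Import numFieldNormedType.Exports.

Local Open Scope classical_set_scope.
Local Open Scope ring_scope.

(** * Paths of point processes *)

(** The indicator of Z_1 + X_t >= z reads the final noise, so it is in general not adapted. A grid
    keeps its exchange with the price elementary: each term pairs one increment of X with the noise
    to come, and conditioning on lattice-valued variables is a countable sum. The right endpoint
    serves twice. The increment is known to the insider there, and the price there already includes
    the order, as in all six parts of the profit. Convexity enters because the indicator minus v is
    a subgradient of the potential at the position reached: a trade of any size or sign gains at
    most the drop of the potential, and a single step in the direction favoured by v gains exactly
    that drop. *)

Section PointPaths.
Context {R : realType}.
Implicit Types (x f : R -> R) (c t : R) (J : seq R).

Lemma sumr_const_seq (I : Type) (r : seq I) (p : pred I) c :
  \sum_(s <- r | p s) c = c *+ count p r.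
Proof. by rewrite big_const_seq iter_addr_0. Qed.

(** [J] may contain repetitions: jumps are then counted with multiplicity, which is how
    [passage_uniq] rules repetitions out. *)
Record steps c J x : Prop := Steps {
  steps_itv : forall s, s \in J -> 0 < s <= 1 ;
  steps_sum : forall t, 0 <= t <= 1 -> x t = \sum_(s <- J | s <= t) c }.

Lemma near_left_le J t : \forall s \near t^'-, all (fun j => (j <= s) == (j < t)) J.
Proof.
elim: J => [|j J IH]; first exact: nearW.
have : \forall s \near t^'-, (j <= s) == (j < t).
  have [jt|tj] := ltP j t; first by apply: filterS (nbhs_left_ge jt) => s ->.
  by apply: filterS (nbhs_left_lt t) => s st; rewrite leNgt (lt_le_trans st tj).
by apply: filterS2 IH => s /= -> ->.
Qed.

Lemma steps_left_cvg c J x t : steps c J x -> 0 < t <= 1 ->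
  x s @[s --> t^'-] --> \sum_(s <- J | s < t) c.
Proof.
move=> [Jitv xE] /andP[t0 t1]; apply: cvg_near_cst.
near=> s.
rewrite xE; last first.
  apply/andP; split; first by near: s; exact: nbhs_left_ge.
  by rewrite (le_trans _ t1)//; near: s; exact: nbhs_left_le.
have /allP Js : all (fun j => (j <= s) == (j < t)) J.
  by near: s; exact: near_left_le.
rewrite big_seq_cond [RHS]big_seq_cond; apply: eq_bigl => j.
by case: (boolP (j \in J)) => //= /Js/eqP.
Unshelve. all: by end_near. Qed.

Lemma steps_left_lim c J x t : steps c J x -> 0 < t <= 1 ->
  left_lim x t = \sum_(s <- J | s < t) c.
Proof. by move=> xJ t01; apply/cvg_lim => //; exact: steps_left_cvg. Qed.

Lemma steps_jump_count c J x t : steps c J x -> 0 < t <= 1 ->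
  jump x t = c *+ count_mem t J.
Proof.
move=> xJ t01; rewrite /jump (steps_left_lim xJ)// (steps_sum xJ); last first.
  by case/andP: t01 => /ltW -> ->.
rewrite big_mkcond [X in _ - X]big_mkcond -sumrB/=.
rewrite -sumr_const_seq [RHS]big_mkcond/=; apply: eq_bigr => s _.
by case: ltgtP; rewrite ?subrr ?subr0.
Qed.

Lemma steps_jump c J x t : uniq J -> steps c J x -> 0 < t <= 1 ->
  jump x t = if t \in J then c else 0.
Proof.
move=> uJ xJ t01; rewrite (steps_jump_count xJ)// count_uniq_mem//.
by case: (t \in J).
Qed.

Lemma steps_jumps_in c J x (D : set R) : uniq J -> steps c J x ->
  steps c [seq s <- J | s \in D] (jumps_in D x).
Proof.
move=> uJ xJ; split=> [s|t /andP[t0 t1]].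
  by rewrite mem_filter => /andP[_]; exact: (steps_itv xJ).
have st s : `]0%R, t]%classic s -> 0 < s <= 1.
  by rewrite /= in_itv/= => /andP[-> /le_trans ->].
rewrite /jumps_in (fsbigE [seq s <- J | (s <= t) && (s \in D)]); first last.
- move=> s [/= s0t Ds]; rewrite mem_filter mem_set//.
  move: (s0t); rewrite /= in_itv/= => /andP[s0 ->]/=.
  by rewrite (steps_jump uJ xJ) ?(st _ s0t)// => /negbTE ->.
- move=> s /=; rewrite mem_filter => /andP[/andP[s_t /set_mem sD] /(steps_itv xJ)].
  by case/andP=> s0 _; split => //=; rewrite in_itv/= s0.
- exact: filter_uniq.
rewrite big_filter_cond [RHS]big_filter_cond big_seq_cond [RHS]big_seq_cond.
rewrite [LHS](eq_bigl (fun s => [&& s \in J, s \in D & s <= t])); last first.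
  move=> s; case sJ: (s \in J) => //=; case: (boolP (s \in D)) => sD/=; last first.
    by rewrite andbF.
  case sT: (s <= t) => //=; apply/mem_set; split; last exact/set_mem.
  by rewrite /= in_itv/= sT andbT; have /andP[] := steps_itv xJ sJ.
apply: eq_bigr => s /and3P[sJ sD _].
by rewrite (steps_jump uJ xJ) ?sJ//; exact: (steps_itv xJ).
Qed.

Lemma steps_point_integral c J x h : uniq J -> steps c J x ->
  point_integral h x = \sum_(s <- J) h s * c.
Proof.
move=> uJ xJ; rewrite /point_integral (fsbigE J)//; first last.
- by move=> s; rewrite /= in_itv/= => s01 /negbTE sJ;
    rewrite (steps_jump uJ xJ)// sJ mulr0.
- by move=> s /= /(steps_itv xJ); rewrite in_itv.
rewrite big_seq_cond [RHS]big_seq_cond; apply: eq_big => s.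
  case sJ: (s \in J) => //=; apply/mem_set.
  by rewrite /= in_itv/=; exact: (steps_itv xJ).
case/andP=> sJ _; rewrite (steps_jump uJ xJ) ?sJ//; exact: (steps_itv xJ).
Qed.

Lemma steps_scale c J x a : steps c J x -> steps (a * c) J (fun t => a * x t).
Proof. by case=> xJ xE; split => // t /xE ->; rewrite mulr_sumr. Qed.

Lemma steps_lt c J x s a b : 0 < c -> steps c J x -> s \in J -> 0 <= a ->
  a < s <= b -> b <= 1 -> x a < x b.
Proof.
move=> c0 hJ sJ a0 /andP[as_ sb] b1; have ab := lt_le_trans as_ sb.
rewrite !(steps_sum hJ) ?a0 ?b1 ?(le_trans a0 (ltW ab)) ?(le_trans (ltW ab) b1)//.
rewrite !sumr_const_seq ltr_pMn2l//.
have -> : count (fun j => j <= b) J =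
    (count (fun j => j <= a)%R J + count (fun j => a < j <= b)%R J)%N.
  elim: (J) => //= j K ->; rewrite addnACA; congr (_ + _)%N.
  by case: (leP j a) => //= /le_trans ->//; exact: ltW.
by rewrite -addn1 leq_add2l -has_count; apply/hasP; exists s => //; rewrite as_.
Qed.

(** Stated inside [0, 1] since paths are unconstrained after time 1; at [s = 1] it holds
    trivially. *)
Definition right_cont01 f s := forall e : R, 0 < e -> exists2 r : R, 0 < r &
  forall t, s <= t -> t <= 1 -> t - s < r -> `|f t - f s| < e.

Lemma steps_right_const c J x s : steps c J x -> 0 <= s -> exists2 r : R, 0 < r &
  forall t, s <= t -> t <= 1 -> t - s < r -> x t = x s.
Proof.
move=> xJ s0.
have [r r0 rP] : exists2 r : R, 0 < r & forall t, s <= t -> t - s < r ->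
    forall j, j \in J -> (j <= t) = (j <= s).
  elim: J {xJ} => [|j J [r r0 IH]]; first by exists 1.
  have [js|sj] := leP j s.
    exists r => // t st tsr k; rewrite inE => /predU1P[->|]; last exact: IH.
    by rewrite js (le_trans js).
  exists (Num.min r (j - s)); first by rewrite lt_min r0 subr_gt0.
  move=> t st; rewrite lt_min => /andP[tsr tsj] k.
  rewrite inE => /predU1P[->|]; last exact: IH.
  by rewrite !leNgt sj; rewrite ltrD2r in tsj; rewrite tsj.
exists r => // t st t1 tsr.
rewrite !(steps_sum xJ) ?s0 ?(le_trans s0 st) ?(le_trans st t1)//.
rewrite big_seq_cond [RHS]big_seq_cond; apply: eq_bigl => j.
by case jJ: (j \in J) => //=; exact: rP.
Qed.

(** * Jump times as first passage times *)

Section FirstPassage.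
Variables (c : R) (x : R -> R) (n : nat).
Hypotheses (c0 : 0 < c) (xP : point_path c x) (x1 : x 1 = c *+ n).

Definition passage (k : nat) : R := inf [set t | 0 <= t <= 1 /\ c *+ k.+1 <= x t].

(** Right-continuity makes the infimum a minimum; [k < n] makes the set nonempty, since it then
    contains 1. *)
Lemma passage_le k t : (k < n)%N -> 0 <= t <= 1 ->
  (passage k <= t) = (c *+ k.+1 <= x t).
Proof.
move=> kn t01.
set A := [set t | 0 <= t <= 1 /\ c *+ k.+1 <= x t].
have A1 : A 1 by split; rewrite ?ler01 ?lexx// x1 ler_pMn2l.
have lA : has_lbound A by exists 0 => s [/andP[]].
have iA : has_inf A by split => //; exists 1.
have s0 : 0 <= passage k by apply: lb_le_inf; [exists 1|move=> s [/andP[]]].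
have s1 : passage k <= 1 by exact: (ge_inf lA).
have As : A (passage k).
  split; first by rewrite s0.
  have [->|sN1] := eqVneq (passage k) 1; first by case: A1.
  have slt : passage k < 1 by rewrite lt_neqAle sN1.
  have xs : x s @[s --> (passage k)^'+] --> x (passage k).
    by apply: (point_path_right_continuous xP); rewrite s0.
  apply: (cvgr_to_ge xs); near=> s.
  have ss : passage k < s by near: s; exact: nbhs_right_gt.
  have [u [/andP[u0 u1] Au] us] := inf_adherent (eps := s - passage k)
    ltac:(by rewrite subr_gt0) iA.
  have {}us : u < s by move: us; rewrite -/(passage k) addrC subrK.
  apply: (le_trans Au); apply: (point_path_nondecreasing xP) => //; first exact: ltW.
  by near: s; exact: nbhs_right_le.
apply/idP/idP => [st|xt]; last exact: (ge_inf lA).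
apply: (le_trans As.2); apply: (point_path_nondecreasing xP) => //.
by case/andP: t01.
Unshelve. all: by end_near. Qed.

Let J := [seq passage k | k <- iota 0 n].

Lemma passage_itv k : (k < n)%N -> 0 < passage k <= 1.
Proof.
move=> kn; apply/andP; split; last first.
  by rewrite passage_le ?ler01 ?lexx// x1 ler_pMn2l.
rewrite ltNge passage_le ?ler01 ?lexx// (point_path0 xP) -ltNge.
by rewrite pmulrn_lgt0.
Qed.

(** When [x] is worth m steps, exactly the first m levels have been reached, so counting passage
    times recovers [x]. *)
Lemma passage_steps : steps c J x.
Proof.
split=> [s|t t01].
  by case/mapP=> k; rewrite mem_iota add0n => kn ->; exact: passage_itv.
have [m xm] := point_path_lattice xP t01.
have mn : (m <= n)%N.
  rewrite -(ler_pMn2l c0) -xm -x1; apply: (point_path_nondecreasing xP) => //;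
  by case/andP: t01.
rewrite big_map big_seq_cond.
rewrite (eq_bigl (fun k => (k \in iota 0 n) && (k < m)%N)); last first.
  move=> k; rewrite mem_iota add0n; case kn: (k < n)%N => //=.
  by rewrite passage_le// xm ler_pMn2l.
rewrite -big_seq_cond xm -{1}(subn0 n) -/(index_iota 0 n).
by rewrite -(big_nat_widen 0 m n predT)// sumr_const_nat subn0.
Qed.

(** A repeated time would carry a jump of at least 2c, while [point_path_jump] allows only 0 or
    c. *)
Lemma passage_uniq : uniq J.
Proof.
apply: count_mem_uniq => t.
have [tJ|/count_memPn ->//] := boolP (t \in J).
have t01 := steps_itv passage_steps tJ.
have := steps_jump_count passage_steps t01.
have : (0 < count_mem t J)%N by rewrite -has_count has_pred1.
case: (point_path_jump xP t01) => ->.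
  by case: count => // m _ /esym/eqP; rewrite mulrn_eq0 (gt_eqF c0).
move=> c_gt0 cE; have : c *+ count_mem t J <= c *+ 1 by rewrite -cE mulr1n.
by rewrite ler_pMn2l// => c_le1; apply/eqP; rewrite eqn_leq c_le1.
Qed.

(** Levels are reached without overshoot. This later turns a sum over jump times into a sum over
    levels. *)
Lemma passage_values : [seq x s | s <- J] = [seq c *+ k.+1 | k <- iota 0 n].
Proof.
rewrite -map_comp; apply/eq_in_map => k; rewrite mem_iota add0n /= => kn.
have /andP[/ltW s0 s1] := passage_itv kn.
have s01 : 0 <= passage k <= 1 by rewrite s0.
have := lexx (passage k); rewrite passage_le//.
have [m xm] := point_path_lattice xP s01.
rewrite xm ler_pMn2l// => km; congr (_ *+ _); apply/eqP.
(* An overshoot at [passage k] would make the next passage time equal to it, against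
   [passage_uniq]. *)
rewrite eqn_leq km andbT leqNgt; apply/negP => km1.
have mn : (m <= n)%N.
  by rewrite -(ler_pMn2l c0) -xm -x1; apply: (point_path_nondecreasing xP).
have k1n : (k.+1 < n)%N := leq_trans km1 mn.
have : passage k.+1 = passage k.
  apply/eqP; rewrite eq_le passage_le// xm ler_pMn2l// km1/=.
  have /andP[/ltW u0 u1] := passage_itv k1n.
  rewrite passage_le ?u0//; apply: (@le_trans _ _ (c *+ k.+2)).
    by rewrite ler_pMn2l.
  by rewrite -passage_le ?u0 ?lexx.
have szJ : size J = n by rewrite size_map size_iota.
have nthJ i : (i < n)%N -> nth 0 J i = passage i.
  by move=> i_n; rewrite (nth_map 0%N) ?size_iota// nth_iota.
rewrite -!nthJ// => /eqP; rewrite nth_uniq ?szJ//; last exact: passage_uniq.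
by rewrite gtn_eqF.
Qed.

End FirstPassage.

Lemma point_path_steps c x : 0 < c -> point_path c x -> exists J, [/\ uniq J,
  steps c J x, x 1 = c *+ size J &
  [seq x s | s <- J] = [seq c *+ k.+1 | k <- iota 0 (size J)] ].
Proof.
move=> c0 xP; have [|n x1] := point_path_lattice xP (t := 1).
  by rewrite ler01 lexx.
exists [seq passage c x k | k <- iota 0 n]; split.
- exact: passage_uniq.
- exact: passage_steps.
- by rewrite size_map size_iota.
- by rewrite size_map size_iota; exact: passage_values.
Qed.

End PointPaths.

(** * Riemann-Stieltjes sums on a uniform grid *)

Section RiemannSums.
Context {R : realType}.
Implicit Types (x f : R -> R) (c t : R) (J : seq R).

(* The points of the n-th grid are k/(n+1), to avoid a division by 0. *)
Definition mesh n k : R := k%:R / n.+1%:R.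

Definition riemann f x n : R :=
  \sum_(i < n.+1) f (mesh n i.+1) * (x (mesh n i.+1) - x (mesh n i)).

Lemma mesh0 n : mesh n 0 = 0. Proof. by rewrite /mesh mul0r. Qed.
Lemma mesh1 n : mesh n n.+1 = 1. Proof. by rewrite /mesh divff. Qed.
Lemma le_mesh n i j : (i <= j)%N -> mesh n i <= mesh n j.
Proof. by move=> ij; rewrite ler_pM2r ?invr_gt0 ?ltr0Sn// ler_nat. Qed.
Lemma meshS n i : mesh n i.+1 = mesh n i + n.+1%:R^-1.
Proof. by rewrite /mesh -natr1 mulrDl mul1r. Qed.
Lemma mesh_itv n i : (i <= n.+1)%N -> 0 <= mesh n i <= 1.
Proof. by move=> i_n; rewrite -{1}(mesh0 n) -(mesh1 n) !le_mesh. Qed.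

Lemma mesh_cell n s : 0 < s <= 1 ->
  exists2 i : 'I_n.+1, mesh n i < s <= mesh n i.+1 &
    forall j : 'I_n.+1, mesh n j < s <= mesh n j.+1 -> j = i.
Proof.
move=> /andP[s0 s1].
have ex : exists k, s <= mesh n k by exists n.+1; rewrite mesh1.
have [k sk kmin] := ex_minnP ex.
case: k sk kmin => [|i] si imin; first by move: si; rewrite mesh0 leNgt s0.
have i_n : (i < n.+1)%N by apply: imin; rewrite mesh1.
exists (Ordinal i_n) => /=.
  by rewrite si andbT ltNge; apply/negP => /imin; rewrite ltnn.
move=> j /andP[js sj]; apply/val_inj/eqP; rewrite eqn_leq/= -[(i <= j)%N]ltnS.
rewrite imin// andbT leqNgt; apply/negP => ij.
by move: js; rewrite ltNge (le_trans si)// le_mesh.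
Qed.

(** Exchanging the sums leaves, for each jump time, the value of [f] at the right end of the cell
    that contains it. *)
Lemma riemann_steps f x c J n : steps c J x -> riemann f x n =
  \sum_(s <- J) \sum_(i < n.+1 | mesh n i < s <= mesh n i.+1) f (mesh n i.+1) * c.
Proof.
move=> xJ; rewrite (eq_bigr _ (fun s _ => big_mkcond _ _)) exchange_big/=.
apply: eq_bigr => i _.
rewrite !(steps_sum xJ) ?mesh_itv//; last exact: ltnW (ltn_ord i).
rewrite big_mkcond [X in _ - X]big_mkcond -sumrB/= mulr_sumr.
apply: eq_bigr => s _.
have [si|si] := leP s (mesh n i) => /=.
  by rewrite (le_trans si) ?le_mesh// subrr mulr0.
by case: ifP; rewrite subr0 ?mulr0.
Qed.

(** The right end of the cell of a jump time [s] is not before [s] and lies within 1/(n+1) of it, so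
    right-continuity of [f] at [s] applies. *)
Lemma riemann_cvg f x c J : steps c J x ->
  (forall s, s \in J -> right_cont01 f s) ->
  riemann f x n @[n --> \oo] --> \sum_(s <- J) f s * c.
Proof.
move=> xJ fJ.
rewrite (_ : riemann f x = fun n => \sum_(s <- J | s \in J) \sum_(i < n.+1 |
    mesh n i < s <= mesh n i.+1) f (mesh n i.+1) * c); last first.
  by apply/funext => n; rewrite (riemann_steps _ _ xJ) big_seq.
rewrite big_seq.
apply: cvg_big => [|s sJ]; first exact: add_continuous.
rewrite -[X in X @ _](_ : (fun n => (\sum_(i < n.+1 |
    mesh n i < s <= mesh n i.+1) f (mesh n i.+1)) * c) = _); last first.
  by apply/funext => n; rewrite mulr_suml.
apply: cvgMl; apply/cvgrPdist_lt => e e0.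
have [r r0 rP] := fJ _ sJ _ e0.
near=> n.
have [i /andP[i_lt si] iP] := mesh_cell n (steps_itv xJ sJ).
rewrite (big_pred1 i); last first.
  move=> j; apply/idP/eqP => [/iP//|->]; by rewrite i_lt.
rewrite distrC; apply: rP => //; first by have /andP[] := @mesh_itv n i.+1 (ltn_ord i).
rewrite meshS; apply: (@lt_trans _ _ n.+1%:R^-1).
  by rewrite ltrBlDr addrC ltrD2l.
by near: n; exact: near_infty_natSinv_lt (PosNum r0).
Unshelve. all: by end_near. Qed.

Lemma riemann_bound f x M n : (forall t, 0 <= t <= 1 -> `|f t| <= M) ->
  (forall s t, 0 <= s -> s <= t -> t <= 1 -> x s <= x t) ->
  `|riemann f x n| <= M * (x 1 - x 0).
Proof.
move=> fM xm.
have xi (i : 'I_n.+1) : 0 <= x (mesh n i.+1) - x (mesh n i).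
  have /andP[a _] := @mesh_itv n i (ltnW (ltn_ord i)).
  have /andP[_ b] := @mesh_itv n i.+1 (ltn_ord i).
  by rewrite subr_ge0 xm ?le_mesh.
have <- : \sum_(i < n.+1) (x (mesh n i.+1) - x (mesh n i)) = x 1 - x 0.
  rewrite -(big_mkord xpredT (fun i => x (mesh n i.+1) - x (mesh n i))).
  by rewrite (telescope_sumr (fun i => x (mesh n i))) ?mesh0 ?mesh1.
apply: (le_trans (ler_norm_sum _ _ _)); rewrite mulr_sumr.
apply: ler_sum => i _; rewrite normrM (ger0_norm (xi i)) ler_wpM2r//.
by apply: fM; exact: mesh_itv (ltn_ord i).
Qed.

End RiemannSums.
(** * Independence and Poisson increments *)

Section Independence.
Context {R : realType} {d : measure_display} {T : measurableType d}.
Variable P : probability T R.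
Implicit Types (F G H : set (set T)) (V W : T -> R) (A B C : set T).

Lemma sigma_setI F A B : sigma_algebra setT F -> F A -> F B -> F (A `&` B).
Proof.
move=> sF; rewrite -(measurable_g_measurableTypeE sF).
exact: (@measurableI _ (g_sigma_algebraType F)).
Qed.

Lemma sigma_setU F A B : sigma_algebra setT F -> F A -> F B -> F (A `|` B).
Proof.
move=> sF; rewrite -(measurable_g_measurableTypeE sF).
exact: (@measurableU _ (g_sigma_algebraType F)).
Qed.

Lemma sigma_setD F A B : sigma_algebra setT F -> F A -> F B -> F (A `\` B).
Proof.
move=> sF; rewrite -(measurable_g_measurableTypeE sF).
exact: (@measurableD _ (g_sigma_algebraType F)).
Qed.

Lemma sigma_setT F : sigma_algebra setT F -> F setT.
Proof. by case=> F0 FC _; rewrite -(setD0 setT); exact: FC. Qed.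

Lemma sigma_rv_sigma_algebra V : sigma_algebra setT (sigma_rv V).
Proof. apply: sigma_algebra_preimage; exact: sigma_algebra_measurable. Qed.

Lemma sigma_rv_preimage V (B : set R) : measurable B -> sigma_rv V (V @^-1` B).
Proof. by move=> mB; exists B => //; rewrite setTI. Qed.

Lemma sigma_rv_subP F V : sigma_algebra setT F ->
  sigma_rv V `<=` F <-> measurable_fun setT (V : g_sigma_algebraType F -> R).
Proof.
move=> sF; split=> [VF _ B mB|mV _ [B mB <-]].
  rewrite setTI measurable_g_measurableTypeE//.
  exact/VF/sigma_rv_preimage.
have := mV (@measurableT _ (g_sigma_algebraType F)) _ mB.
by rewrite measurable_g_measurableTypeE.
Qed.

Lemma sigma_rv_measurable V : sigma_rv V `<=` measurable <-> measurable_fun setT V.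
Proof.
split=> [VF _ B mB|mV _ [B mB <-]]; last exact: mV.
by rewrite setTI; exact/VF/sigma_rv_preimage.
Qed.

Lemma sigma_rv_comp (g : R -> R) V : measurable_fun setT g ->
  sigma_rv (g \o V) `<=` sigma_rv V.
Proof.
move=> mg _ [B mB <-]; exists (g @^-1` B) => //.
by rewrite -[X in measurable X]setTI; exact: mg.
Qed.

Lemma sigma_rv_subB F V W : sigma_algebra setT F ->
  sigma_rv V `<=` F -> sigma_rv W `<=` F -> sigma_rv (fun w => V w - W w) `<=` F.
Proof.
move=> sF /(sigma_rv_subP _ sF) mV /(sigma_rv_subP _ sF) mW.
by apply/(sigma_rv_subP _ sF); exact: measurable_funB.
Qed.

Lemma sigma_rv_subD F V W : sigma_algebra setT F ->
  sigma_rv V `<=` F -> sigma_rv W `<=` F -> sigma_rv (fun w => V w + W w) `<=` F.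
Proof.
move=> sF /(sigma_rv_subP _ sF) mV /(sigma_rv_subP _ sF) mW.
by apply/(sigma_rv_subP _ sF); exact: measurable_funD.
Qed.

Lemma sigma_rv_scale F c V : sigma_rv V `<=` F -> sigma_rv (fun w => c * V w) `<=` F.
Proof.
move=> VF; apply: (subset_trans _ VF); apply: (sigma_rv_comp (g := fun x => c * x)).
exact: measurable_funM.
Qed.

Notation pr A := (fine (P A)).

Lemma prE A : measurable A -> P A = (pr A)%:E.
Proof. by move=> mA; rewrite fineK// fin_num_measure. Qed.

Lemma pr_ge0 A : 0 <= pr A. Proof. exact: fine_ge0. Qed.

Lemma pr_le A B : measurable A -> measurable B -> A `<=` B -> pr A <= pr B.
Proof.
move=> mA mB AB; apply: fine_le; rewrite ?fin_num_measure//.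
by apply: le_measure; rewrite ?inE.
Qed.

Lemma pr_le1 A : measurable A -> pr A <= 1.
Proof. by move=> mA; rewrite -lee_fin -prE//; exact: probability_le1. Qed.

Lemma pr_setC A : measurable A -> pr (~` A) = 1 - pr A.
Proof.
by move=> mA; rewrite probability_setC// fineB ?fin_num_measure.
Qed.

Lemma pr_setU A B : measurable A -> measurable B -> pr (A `|` B) <= pr A + pr B.
Proof.
move=> mA mB; rewrite -lee_fin EFinD -!prE//; last exact: measurableU.
exact: measureU2.
Qed.

Lemma pr_split A B : measurable A -> measurable B ->
  pr A = pr (A `&` B) + pr (A `\` B).
Proof.
move=> mA mB; rewrite addrC (measureDI P mA mB) fineD ?fin_num_measure//.
  exact: measurableD.
exact: measurableI.
Qed.

Lemma indepC G H : indep P G H -> indep P H G.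
Proof. by move=> GH A B HA GB; rewrite setIC muleC; exact: GH. Qed.

Lemma indepS G H G' H' : G' `<=` G -> H' `<=` H -> indep P G H -> indep P G' H'.
Proof. by move=> GG HH GH A B /GG GA /HH HB; exact: GH. Qed.

(** Dynkin's pi-lambda theorem: for a fixed [B], the events independent of [B] form a
    lambda-system. *)
Lemma indep_generatedl G H : setI_closed G -> G `<=` measurable ->
  H `<=` measurable -> indep P G H -> indep P <<s G >> H.
Proof.
move=> GI mG mH GH A B sA HB.
pose L := [set A | measurable A /\ P (A `&` B) = (P A * P B)%E].
have mB := mH _ HB.
suff : <<s G >> `<=` L by move=> /(_ _ sA)[].
apply: lambda_system_subset => //; last first.
  by move=> C GC; split; [exact: mG|exact: GH].
apply/dynkin_lambda_system; split.
- by split; [exact: measurableT|rewrite setTI probability_setT mul1e].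
- move=> C [mC CE]; split; first exact: measurableC.
  have mCB : measurable (~` C `&` B) by apply: measurableI => //; exact: measurableC.
  have := pr_split mB mC; rewrite setDE (setIC B C) (setIC B) CE.
  rewrite [P (~` C `&` B)]prE// [P (~` C)]prE; last exact: measurableC.
  rewrite pr_setC// (prE mB) (prE mC) -!EFinM => E.
  by congr EFin; rewrite mulrBl mul1r; apply/eqP; rewrite eq_sym subr_eq addrC -E.
- move=> F tF FL; have mF n : measurable (F n) by have [] := FL n.
  split; first exact: bigcupT_measurable.
  rewrite setI_bigcupl !measure_bigcup//=.
  + rewrite -[P B]fineK ?fin_num_measure// muleC -nneseriesZl//.
    by apply: eq_eseriesr => n _; rewrite fineK ?fin_num_measure// muleC (FL n).2.
  + by move=> n _; exact: measurableI.
  + exact: trivIset_setIr.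
Qed.

Lemma generated_measurable G : G `<=` measurable -> <<s G >> `<=` measurable.
Proof. by apply: smallest_sub; exact: sigma_algebra_measurable. Qed.

Lemma indep_generated G H : setI_closed G -> setI_closed H ->
  G `<=` measurable -> H `<=` measurable ->
  indep P G H -> indep P <<s G >> <<s H >>.
Proof.
move=> GI HI mG mH GH; apply: indep_generatedl => //.
  exact: generated_measurable.
by apply/indepC/indep_generatedl => //; exact: indepC.
Qed.

(** For two sigma-algebras this is a pi-system that generates their join. *)
Definition meets G H : set (set T) :=
  [set A | exists B C, [/\ G B, H C & A = B `&` C]].

Lemma meets_setI_closed G H : setI_closed G -> setI_closed H ->
  setI_closed (meets G H).
Proof.
move=> GI HI _ _ [A [B [GA HB ->]]] [C [D [GC HD ->]]].
by exists (A `&` C), (B `&` D); rewrite setIACA; split; [exact: GI|exact: HI|].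
Qed.

Lemma meets_measurable G H : G `<=` measurable -> H `<=` measurable ->
  meets G H `<=` measurable.
Proof. by move=> mG mH _ [A [B [/mG ? /mH ? ->]]]; exact: measurableI. Qed.

Lemma setU_meets G H : G setT -> H setT -> G `|` H `<=` meets G H.
Proof.
by move=> GT HT A [|] ?; [exists A, setT|exists setT, A]; rewrite ?setIT ?setTI.
Qed.

Lemma sigma_setI_closed F : sigma_algebra setT F -> setI_closed F.
Proof. by move=> sF A B; exact: sigma_setI. Qed.

(** A fourfold intersection factors first between the blocks [K1] and [K2], then inside each block.
    Independent increments of two independent processes thus become independence of the joint past
    from the joint increment. *)
Lemma indep_regroup G1 D1 G2 D2 K1 K2 :
  sigma_algebra setT G1 -> sigma_algebra setT D1 -> sigma_algebra setT G2 ->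
  sigma_algebra setT D2 -> sigma_algebra setT K1 -> sigma_algebra setT K2 ->
  K1 `<=` measurable -> K2 `<=` measurable ->
  G1 `<=` K1 -> D1 `<=` K1 -> G2 `<=` K2 -> D2 `<=` K2 ->
  indep P G1 D1 -> indep P G2 D2 -> indep P K1 K2 ->
  indep P <<s G1 `|` G2 >> <<s D1 `|` D2 >>.
Proof.
move=> sG1 sD1 sG2 sD2 sK1 sK2 mK1 mK2 GK1 DK1 GK2 DK2 i1 i2 iK.
have sub G H : sigma_algebra setT G -> sigma_algebra setT H ->
    <<s G `|` H >> `<=` <<s meets G H >>.
  move=> sG sH; apply: sub_sigma_algebra2; apply: setU_meets; exact: sigma_setT.
apply: (indepS (sub _ _ sG1 sG2) (sub _ _ sD1 sD2)).
apply: indep_generated.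
- by apply: meets_setI_closed; exact: sigma_setI_closed.
- by apply: meets_setI_closed; exact: sigma_setI_closed.
- by apply: meets_measurable; [move=> A /GK1/mK1|move=> A /GK2/mK2].
- by apply: meets_measurable; [move=> A /DK1/mK1|move=> A /DK2/mK2].
move=> _ _ [A [B [GA GB ->]]] [C [D [DC DD ->]]].
rewrite setIACA iK; last 2 first.
- by apply: sigma_setI => //; [exact: GK1|exact: DK1].
- by apply: sigma_setI => //; [exact: GK2|exact: DK2].
rewrite i1// i2// iK; [|exact: GK1|exact: GK2].
rewrite iK; [|exact: DK1|exact: DK2].
by rewrite muleACA.
Qed.

Lemma pr_indep G H A B : G `<=` measurable -> H `<=` measurable ->
  indep P G H -> G A -> H B -> pr (A `&` B) = pr A * pr B.
Proof.
move=> mG mH GH GA HB; rewrite GH// fineM// fin_num_measure//.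
  exact: mG.
exact: mH.
Qed.

Lemma pr_dist A B C : measurable A -> measurable B -> measurable C ->
  (forall w, ~ C w -> A w <-> B w) -> `|pr A - pr B| <= pr C.
Proof.
move=> mA mB mC AB.
rewrite (pr_split mA mC) (pr_split mB mC).
have -> : A `\` C = B `\` C.
  by apply/seteqP; split=> w [Aw Cw]; split => //; apply/(AB _ Cw).
have := pr_le (measurableI _ _ mA mC) mC (@subIsetr _ _ _).
have := pr_le (measurableI _ _ mB mC) mC (@subIsetr _ _ _).
have := pr_ge0 (A `&` C); have := pr_ge0 (B `&` C).
by move=> *; rewrite ler_norml; apply/andP; split; lra.
Qed.

End Independence.
Section NaturalFiltration.
Context {R : realType} {d : measure_display} {T : measurableType d}.
Implicit Types (N : R -> T -> R) (F : set (set T)) (s t : R).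

Lemma natural_adapted N s t : 0 <= s -> s <= t ->
  sigma_rv (N s) `<=` natural_filtration N t.
Proof.
move=> s0 st A NA; apply: sub_sigma_algebra; exists s => //=.
by rewrite in_itv/= s0.
Qed.

Lemma natural_sub N F t : sigma_algebra setT F ->
  (forall s, 0 <= s -> s <= t -> sigma_rv (N s) `<=` F) ->
  natural_filtration N t `<=` F.
Proof.
move=> sF NF; apply: smallest_sub => // A [s /=].
by rewrite in_itv/= => /andP[s0 st]; exact: NF.
Qed.

Lemma natural_le N s t : s <= t -> natural_filtration N s `<=` natural_filtration N t.
Proof.
move=> st; apply: natural_sub; first exact: smallest_sigma_algebra.
by move=> u u0 us; apply: natural_adapted => //; exact: le_trans st.
Qed.

End NaturalFiltration.

(** * Differences of two independent Poisson processes *)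

Section PoissonPair.
Context {R : realType} {d : measure_display} {T : measurableType d}.
Variables (P : probability T R) (beta : R).
Hypothesis beta0 : 0 < beta.
Implicit Types (N M : R -> T -> R) (s t y : R).

Local Notation pr A := (fine (P A)).

Definition incr N s t : T -> R := fun w => N t w - N s w.

Lemma incr_nat N s t w : poisson_process P beta N -> 0 <= s -> s <= t -> t <= 1 ->
  exists k : nat, incr N s t w = k%:R.
Proof.
move=> pN s0 st t1; have pw := poisson_path pN w.
have [n Nt] := point_path_lattice pw (t := t) ltac:(by rewrite (le_trans s0)).
have [m Ns] := point_path_lattice pw (t := s) ltac:(by rewrite s0 (le_trans st)).
have := point_path_nondecreasing pw s0 st t1; rewrite /incr Nt Ns ler_nat => mn.
by exists (n - m)%N; rewrite natrB.
Qed.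

Lemma incr_natural N s t u : 0 <= s -> s <= t -> t <= u ->
  sigma_rv (incr N s t) `<=` natural_filtration N u.
Proof.
move=> s0 st tu; apply: sigma_rv_subB; first exact: smallest_sigma_algebra.
  by apply: natural_adapted => //; exact: le_trans st.
by apply: natural_adapted => //; exact: le_trans tu.
Qed.

Lemma natural_measurable N t : poisson_process P beta N -> t <= 1 ->
  natural_filtration N t `<=` measurable.
Proof.
move=> pN t1; apply: natural_sub; first exact: sigma_algebra_measurable.
move=> s s0 st; apply/sigma_rv_measurable/(poisson_measurable pN).
by rewrite s0 (le_trans st).
Qed.

Lemma incr_measurable N s t (B : set R) : poisson_process P beta N ->
  0 <= s -> s <= t -> t <= 1 -> measurable B -> measurable (incr N s t @^-1` B).
Proof.
move=> pN s0 st t1 mB; apply: (natural_measurable pN (lexx 1)).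
by apply: (incr_natural s0 st t1); exact: sigma_rv_preimage.
Qed.

Lemma pr_incr N s t k : poisson_process P beta N -> 0 <= s -> s < t -> t <= 1 ->
  pr (incr N s t @^-1` [set k%:R]) =
  (beta * (t - s)) ^+ k * k`!%:R^-1 * expR (- (beta * (t - s))).
Proof.
move=> pN s0 st t1; rewrite /preimage/= (poisson_increment_law pN)//= /poisson_pmf.
by rewrite mulr_gt0// subr_gt0.
Qed.

(** With h = beta (t - s) the probability is 1 - exp(-h), and exp(-h) >= 1 - h. The case [s = t] is
    separate because the increment law is given only for [s < t]. *)
Lemma pr_incr_neq0 N s t : poisson_process P beta N -> 0 <= s -> s <= t -> t <= 1 ->
  pr (~` (incr N s t @^-1` [set 0])) <= beta * (t - s).
Proof.
move=> pN s0; rewrite le_eqVlt => /predU1P[-> t1|st t1].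
  rewrite subrr mulr0 (_ : _ @^-1` _ = setT) ?setCT ?measure0//.
  by apply/seteqP; split=> // w _; rewrite /incr /preimage/= subrr.
rewrite pr_setC; last by apply: incr_measurable => //; exact: ltW.
rewrite (pr_incr 0 pN)// expr0 fact0 invr1 !mul1r.
have := @expR_ge1Dx R (- (beta * (t - s))); lra.
Qed.

Section Pair.
Variables N M : R -> T -> R.
Hypotheses (pN : poisson_process P beta N) (pM : poisson_process P beta M).
Hypothesis NM : indep P (natural_filtration N 1) (natural_filtration M 1).

Definition skellam s t : T -> R := fun w => incr N s t w - incr M s t w.

Definition past t : set (set T) :=
  <<s natural_filtration N t `|` natural_filtration M t >>.

Lemma past_measurable t : t <= 1 -> past t `<=` measurable.
Proof.
move=> t1; apply: generated_measurable => A [] hA.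
  exact: (natural_measurable pN t1).
exact: (natural_measurable pM t1).
Qed.

Lemma past_le s t : s <= t -> past s `<=` past t.
Proof.
by move=> st; apply: sub_sigma_algebra2; apply: setUSS; exact: natural_le.
Qed.

Lemma incr_past s t u : 0 <= s -> s <= t -> t <= u ->
  sigma_rv (incr N s t) `<=` past u /\ sigma_rv (incr M s t) `<=` past u.
Proof.
by move=> s0 st tu; split=> A hA; apply: sub_sigma_algebra; [left|right];
  exact: (incr_natural s0 st tu).
Qed.

Lemma skellam_past s t u : 0 <= s -> s <= t -> t <= u ->
  sigma_rv (skellam s t) `<=` past u.
Proof.
move=> s0 st tu; have [iN iM] := incr_past s0 st tu.
by apply: sigma_rv_subB => //; exact: smallest_sigma_algebra.
Qed.

Lemma skellam_measurable s t (B : set R) : 0 <= s -> s <= t -> t <= 1 ->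
  measurable B -> measurable (skellam s t @^-1` B).
Proof.
move=> s0 st t1 mB; apply: (past_measurable (lexx 1)).
by apply: (skellam_past s0 st t1); exact: sigma_rv_preimage.
Qed.

Lemma past_indep s t : 0 <= s -> s <= t -> t <= 1 ->
  indep P (past s) (sigma_rv (skellam s t)).
Proof.
move=> s0 st t1; have s1 := le_trans st t1.
have sub : sigma_rv (skellam s t) `<=`
    <<s sigma_rv (incr N s t) `|` sigma_rv (incr M s t) >>.
  apply: sigma_rv_subB; first exact: smallest_sigma_algebra.
    by move=> A ?; apply: sub_sigma_algebra; left.
  by move=> A ?; apply: sub_sigma_algebra; right.
apply: (indepS (fun _ => id) sub).
apply: (@indep_regroup _ _ _ P _ _ _ _ (natural_filtration N 1)
  (natural_filtration M 1)) => //; do ?[exact: smallest_sigma_algebra |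
    exact: sigma_rv_sigma_algebra | exact: natural_measurable |
    exact: natural_le | exact: incr_natural ].
- exact: (poisson_increment_indep pN s0 st t1).
- exact: (poisson_increment_indep pM s0 st t1).
Qed.

Lemma pr_incr2 s t j k : 0 <= s -> s < t -> t <= 1 ->
  pr (incr N s t @^-1` [set j%:R] `&` incr M s t @^-1` [set k%:R]) =
  pr (incr N s t @^-1` [set j%:R]) * pr (incr M s t @^-1` [set k%:R]).
Proof.
move=> s0 /ltW st t1.
apply: (pr_indep (natural_measurable pN (lexx 1)) (natural_measurable pM (lexx 1)) NM).
- by apply: (incr_natural s0 st t1); exact: sigma_rv_preimage.
- by apply: (incr_natural s0 st t1); exact: sigma_rv_preimage.
Qed.

Lemma pr_skellam_neq0 s t : 0 <= s -> s <= t -> t <= 1 ->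
  pr (~` (skellam s t @^-1` [set 0])) <= 2 * (beta * (t - s)).
Proof.
move=> s0 st t1.
have mN0 := measurableC (incr_measurable pN s0 st t1 (measurable_set1 0)).
have mM0 := measurableC (incr_measurable pM s0 st t1 (measurable_set1 0)).
have mS0 := measurableC (skellam_measurable s0 st t1 (measurable_set1 0)).
have : ~` (skellam s t @^-1` [set 0]) `<=`
    ~` (incr N s t @^-1` [set 0]) `|` ~` (incr M s t @^-1` [set 0]).
  by rewrite -setCI; apply: subsetC => w [/= nw mw]; rewrite /skellam/= nw mw subrr.
move=> /(pr_le P mS0 (measurableU _ _ mN0 mM0)).
have := pr_setU P mN0 mM0.
have := pr_incr_neq0 pN s0 st t1; have := pr_incr_neq0 pM s0 st t1; lra.
Qed.

Lemma skellamD r s t w : skellam r t w = skellam r s w + skellam s t w.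
Proof. rewrite /skellam /incr; ring. Qed.

(** The bridge price in units of [delta], with [y] the signed distance of the current demand from
    the threshold. *)
Definition skellam_tail y t : R := pr [set w | 0 <= y + skellam t 1 w].

Lemma skellam_tail_set y t :
  [set w | 0 <= y + skellam t 1 w] = skellam t 1 @^-1` `[- y, +oo[.
Proof. by apply/seteqP; split=> w /=; rewrite in_itv/= andbT; lra. Qed.

Lemma skellam_tail_sigma y t :
  sigma_rv (skellam t 1) [set w | 0 <= y + skellam t 1 w].
Proof. by rewrite skellam_tail_set; exact: sigma_rv_preimage. Qed.

Lemma skellam_tail_measurable y t : 0 <= t -> t <= 1 ->
  measurable [set w | 0 <= y + skellam t 1 w].
Proof. by move=> t0 t1; rewrite skellam_tail_set; exact: skellam_measurable. Qed.

Lemma skellam_tail_ge0 y t : 0 <= skellam_tail y t.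
Proof. exact: pr_ge0. Qed.

Lemma skellam_tail_le1 y t : 0 <= t -> t <= 1 -> skellam_tail y t <= 1.
Proof. by move=> t0 t1; apply: pr_le1; exact: skellam_tail_measurable. Qed.

(** The two events differ only where the increment over ]s, t] is nonzero. *)
Lemma skellam_tail_lipschitz y s t : 0 <= s -> s <= t -> t <= 1 ->
  `|skellam_tail y s - skellam_tail y t| <= 2 * (beta * (t - s)).
Proof.
move=> s0 st t1; apply: le_trans (pr_skellam_neq0 s0 st t1).
have t0 := le_trans s0 st; have s1 := le_trans st t1.
apply: pr_dist.
- exact: skellam_tail_measurable.
- exact: skellam_tail_measurable.
- exact/measurableC/skellam_measurable.
- by move=> w /= /contrapT S0; rewrite (skellamD s t) S0 add0r.
Qed.

(* Conditioning on the jumps during ]s, t]: none, one upwards, one downwards;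
   anything else has probability of order (t - s)^2. *)
Lemma skellam_tail_expand y s t : 0 <= s -> s < t -> t <= 1 ->
  `|skellam_tail y s - skellam_tail y t - beta * (t - s) *
     (skellam_tail (y + 1) t + skellam_tail (y - 1) t - 2 * skellam_tail y t)|
  <= 12 * (beta * (t - s)) ^+ 2.
Proof.
move=> s0 st t1; set h := beta * (t - s).
have t0 := le_trans s0 (ltW st); have s1 := le_trans (ltW st) t1.
have h0 : 0 < h by rewrite mulr_gt0// subr_gt0.
pose E (j k : nat) :=
  incr N s t @^-1` [set j%:R] `&` incr M s t @^-1` [set k%:R].
have EP j k : past t (E j k).
  have [iN iM] := incr_past s0 (ltW st) (lexx t).
  by apply: (sigma_setI (smallest_sigma_algebra _ _)); [apply: iN|apply: iM];
    exact: sigma_rv_preimage.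
have mE j k : measurable (E j k) := past_measurable t1 (EP j k).
pose A := [set w | 0 <= y + skellam s 1 w].
have mA : measurable A by exact: skellam_tail_measurable.
(* On [E j k] the tail event at [s] is the one at [t] with [y] shifted by [j - k]. Since [E j k]
   lies in the past of [t], the probability factors. *)
have AE (j k : nat) (e : R) : j%:R - k%:R = e :> R ->
    pr (A `&` E j k) = skellam_tail (y + e) t * pr (E j k).
  move=> jk; rewrite mulrC.
  rewrite -(pr_indep (past_measurable t1) _ (past_indep t0 t1 (lexx 1)) (EP j k)
    (skellam_tail_sigma (y + e) t)); last first.
    by apply/sigma_rv_measurable => _ B mB; rewrite setTI; exact: skellam_measurable.
  rewrite setIC; congr (fine (P _)).
  have Se w : E j k w -> skellam s t w = e.
    by move=> [/= Nw Mw]; rewrite /skellam Nw Mw jk.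
  apply/seteqP; split=> w [w1 w2]; split=> //; move: w2 => /=;
    by rewrite /A/= (skellamD s t) (Se _ w1) (addrA y e).
have sub1 (B F G : set T) : measurable B -> measurable F -> measurable G ->
    G `&` F = set0 -> pr (B `\` F) = pr (B `&` G) + pr (B `\` (F `|` G)).
  move=> mB mF mG GF; rewrite (pr_split P (measurableD mB mF) mG).
  congr (fine (P _) + fine (P _)); last by rewrite setDDl.
  apply/seteqP; split=> w; first by case=> -[].
  case=> Bw Gw; do 2?split => //; move=> Fw.
  by have : set0 w by rewrite -GF.
have E0 : E 1%N 0%N `&` E 0%N 0%N = set0.
  apply/seteqP; split=> // w [[/= w1 _] [/= w0 _]].
  by move: w1; rewrite w0 => /eqP; rewrite eq_sym oner_eq0.
have E1 : E 0%N 1%N `&` (E 0%N 0%N `|` E 1%N 0%N) = set0.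
  apply/seteqP; split=> // w [[/= _ w1] []] [/= _ w0];
  by move: w1; rewrite w0 => /eqP; rewrite eq_sym oner_eq0.
have dec (B : set T) : measurable B ->
    pr B = pr (B `&` E 0%N 0%N) + (pr (B `&` E 1%N 0%N) +
      (pr (B `&` E 0%N 1%N) + pr (B `\` (E 0%N 0%N `|` E 1%N 0%N `|` E 0%N 1%N)))).
  move=> mB; rewrite -sub1//; last exact: measurableU.
  by rewrite -sub1//; exact: pr_split.
have r0 := pr_ge0 P (A `\` (E 0%N 0%N `|` E 1%N 0%N `|` E 0%N 1%N)).
have mE3 : measurable (E 0%N 0%N `|` E 1%N 0%N `|` E 0%N 1%N).
  by do 2?apply: measurableU.
have r1 : pr (A `\` (E 0%N 0%N `|` E 1%N 0%N `|` E 0%N 1%N)) <=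
          pr (setT `\` (E 0%N 0%N `|` E 1%N 0%N `|` E 0%N 1%N)).
  by apply: pr_le; [exact: measurableD|exact: measurableD|exact: setSD].
have := dec _ (@measurableT _ T); rewrite !setTI probability_setT/=.
have := dec _ mA.
rewrite (AE _ _ 0) ?subrr// (AE _ _ 1) ?subr0// (AE _ _ (-1)) ?sub0r// addr0.
rewrite -[pr A]/(skellam_tail y s).
rewrite !pr_incr2// !(pr_incr _ pN)// !(pr_incr _ pM)// -/h.
rewrite !expr0 !expr1 !fact0 !invr1 !mul1r !mulr1.
set r := pr (A `\` _) in r0 r1 *; set r' := pr (setT `\` _) in r1 *.
have q0 := skellam_tail_ge0 y t; have q0' := skellam_tail_le1 y t0 t1.
have q1 := skellam_tail_ge0 (y + 1) t; have q1' := skellam_tail_le1 (y + 1) t0 t1.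
have q2 := skellam_tail_ge0 (y - 1) t; have q2' := skellam_tail_le1 (y - 1) t0 t1.
move: q0 q0' q1 q1' q2 q2'.
set q := skellam_tail y t; set qu := skellam_tail (y + 1) t.
set qd := skellam_tail (y - 1) t.
move=> q0 q0' qu0 qu0' qd0 qd0'.
(* [a] is the probability of no jump at all, between 1 - 2h and 1 - 2h + 4h^2. The error splits into
   four terms bounded by 4h^2, 2h^2, 2h^2 and 4h^2, whose sum is the constant 12. *)
set a := expR (- h) * expR (- h).
have a_ge : 1 - 2 * h <= a.
  rewrite /a -expRD; have := @expR_ge1Dx R (- h - h); lra.
have a_le : a * (1 + 2 * h) <= 1.
  have : a * expR (h + h) = 1 by rewrite /a -!expRD (_ : _ + _ = 0) ?expR0//; lra.
  have := @expR_ge1Dx R (h + h).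
  have : 0 < a by rewrite mulr_gt0 ?expR_gt0.
  nra.
have hN : h * expR (- h) * expR (- h) = h * a by rewrite mulrA.
have Nh : expR (- h) * (h * expR (- h)) = h * a by rewrite /a; ring.
rewrite hN Nh => -> rE.
have a1 : a <= 1 by nra.
have a2 : a <= 1 - 2 * h + 4 * h ^+ 2 by nra.
have h2 : 0 <= h ^+ 2 by exact: sqr_ge0.
have b0 : 0 <= (a - (1 - 2 * h)) * q <= 4 * h ^+ 2.
  apply/andP; split; [apply: mulr_ge0 => //; lra|].
  apply: (@le_trans _ _ (4 * h ^+ 2 * q)); [apply: ler_wpM2r => //; lra|nra].
have b1 : 0 <= h * (1 - a) * qu <= 2 * h ^+ 2.
  apply/andP; split; [by apply: mulr_ge0 => //; apply: mulr_ge0; lra|].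
  apply: (@le_trans _ _ (h * (1 - a))); [|nra].
  by rewrite ler_piMr//; apply: mulr_ge0; lra.
have b2 : 0 <= h * (1 - a) * qd <= 2 * h ^+ 2.
  apply/andP; split; [by apply: mulr_ge0 => //; apply: mulr_ge0; lra|].
  apply: (@le_trans _ _ (h * (1 - a))); [|nra].
  by rewrite ler_piMr//; apply: mulr_ge0; lra.
have rh : r <= 4 * h ^+ 2 by nra.
have -> : q * a + (qu * (h * a) + (qd * (h * a) + r)) - q - h * (qu + qd - 2 * q) =
  (a - (1 - 2 * h)) * q - h * (1 - a) * qu - h * (1 - a) * qd + r by ring.
move: b0 b1 b2 rh r0; set B0 := (a - _) * q; set B1 := _ * qu; set B2 := _ * qd.
move: h2; set H2 := h ^+ 2.
move=> h2 /andP[? ?] /andP[? ?] /andP[? ?] ? ?.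
by rewrite ler_norml; apply/andP; split; lra.
Qed.

End Pair.
End PoissonPair.
(** * The bridge price is a pricing rule *)

Section PricingRule.
Context {R : realType} {d : measure_display} {T : measurableType d}.
Variables (P : probability T R) (beta : R).
Hypothesis beta0 : 0 < beta.

Local Notation pr A := (fine (P A)).

Lemma measure_fibers (c : T -> nat) (A : set T) :
  (forall n, measurable (c @^-1` [set n])) -> measurable A ->
  (P A = \sum_(n <oo) P (A `&` c @^-1` [set n]))%E.
Proof.
move=> mc mA; rewrite -measure_semi_bigcup.
- rewrite -setI_bigcupr (_ : \bigcup_n _ = setT) ?setIT//.
  by apply/seteqP; split=> // w _; exists (c w).
- by move=> n; exact: measurableI.
- apply: trivIset_setIl => i j _ _ [w [/= <- <-]].
  by [].
- by apply: bigcupT_measurable => n; exact: measurableI.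
Qed.

Lemma trunc_incr N s t w : poisson_process P beta N -> 0 <= s -> s <= t -> t <= 1 ->
  (Num.Def.trunc (incr N s t w))%:R = incr N s t w.
Proof.
by move=> pN s0 st t1; have [k ->] := incr_nat w pN s0 st t1; rewrite natrK.
Qed.

Section Law.
Variables N M : R -> T -> R.
Hypotheses (pN : poisson_process P beta N) (pM : poisson_process P beta M).
Hypothesis NM : indep P (natural_filtration N 1) (natural_filtration M 1).

(** One term per pair of jump counts, the pairs being enumerated through [pickle]; integers that
    code no pair contribute 0. Only [r] and [B] enter, so two pairs of processes with the same
    intensity have the same law without computing a convolution. *)
Definition skellam_term (r : R) (B : set R) (n : nat) : \bar R :=
  if (pickle_inv n : option (nat * nat)) is Some jk then
    if (jk.1%:R - jk.2%:R : R) \in B then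
      (r ^+ jk.1 * jk.1`!%:R^-1 * expR (- r) *
       (r ^+ jk.2 * jk.2`!%:R^-1 * expR (- r)))%:E
    else 0%E
  else 0%E.

Lemma skellam_sum s t (B : set R) : 0 <= s -> s < t -> t <= 1 -> measurable B ->
  (P (skellam N M s t @^-1` B) =
   \sum_(n <oo) skellam_term (beta * (t - s)) B n)%E.
Proof.
move=> s0 st t1 mB; have s_t := ltW st.
pose c w := pickle (Num.Def.trunc (incr N s t w), Num.Def.trunc (incr M s t w)).
have cE n : c @^-1` [set n] =
    if (pickle_inv n : option (nat * nat)) is Some jk then
      incr N s t @^-1` [set jk.1%:R] `&` incr M s t @^-1` [set jk.2%:R]
    else set0.
  have := pickle_invK (T := (nat * nat)%type) n.
  case pE : (pickle_inv n : option (nat * nat)) => [[j k]|] /= nE.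
    apply/seteqP; split=> w /=; rewrite /c -nE.
      move=> /(pcan_inj (@pickleK_inv _))[<- <-].
      by rewrite !trunc_incr.
    by move=> [-> ->]; rewrite !natrK.
  apply/seteqP; split=> // w /= cn; move: pE.
  by rewrite -cn pickleK_inv.
rewrite (measure_fibers (c := c)) => [|n|]; last exact: (skellam_measurable pN pM).
  apply: eq_eseriesr => n _; rewrite cE /skellam_term.
  case: pickle_inv => [[j k]|]; last by rewrite setI0 measure0.
  rewrite -(pr_incr beta0 j pN)// -(pr_incr beta0 k pM)// -(pr_incr2 pN pM NM)//=.
  case: ifPn => [/set_mem jkB|/negP jkB].
    rewrite -prE; last first.
      by apply: measurableI; [exact: (incr_measurable pN)|exact: (incr_measurable pM)].
    congr (P _); apply/seteqP; split=> w [] // Nw Mw; split => //.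
    by rewrite /preimage/= /skellam Nw Mw.
  rewrite [X in P X](_ : _ = set0) ?measure0//.
  apply/seteqP; split=> // w [+ [/= Nw Mw]].
  by rewrite /preimage/= /skellam Nw Mw => /mem_set.
rewrite cE; case: pickle_inv => [jk|//].
by apply: measurableI; [exact: (incr_measurable pN)|exact: (incr_measurable pM)].
Qed.

(** The future increment equals -j with positive probability; there the event for [j] occurs while
    the one for [y] fails. *)
Lemma skellam_tail_increasing (j : int) y t : 0 <= t -> t < 1 -> y < j%:~R ->
  skellam_tail P N M y t < skellam_tail P N M j%:~R t.
Proof.
move=> t0 t1 yj; have t_1 := ltW t1.
have [a [b jE]] : exists a b : nat, b%:R - a%:R = j%:~R :> R.
  case: j {yj} => n; first by exists 0%N, n; rewrite subr0.
  by exists n.+1, 0%N; rewrite sub0r NegzE mulrNz.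
pose E := incr N t 1 @^-1` [set a%:R] `&` incr M t 1 @^-1` [set b%:R].
have mE : measurable E.
  by apply: measurableI; [exact: (incr_measurable pN)|exact: (incr_measurable pM)].
have E0 : 0 < pr E.
  rewrite (pr_incr2 pN pM NM)// (pr_incr beta0 _ pN)// (pr_incr beta0 _ pM)//.
  by rewrite !mulr_gt0 ?expR_gt0 ?exprn_gt0 ?invr_gt0 ?ltr0n ?fact_gt0 ?mulr_gt0
    ?subr_gt0.
pose Ay := [set w | 0 <= y + skellam N M t 1 w].
have mAy : measurable Ay by exact: (skellam_tail_measurable pN pM).
have SE w : E w -> skellam N M t 1 w = - j%:~R.
  by move=> [/= Nw Mw]; rewrite /skellam Nw Mw -jE opprB.
have AyE : pr (Ay `|` E) = pr Ay + pr E.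
  rewrite -fineD ?fin_num_measure//; congr fine; apply: measureU => //.
  apply/seteqP; split=> // w [+ /SE Sw]; rewrite /Ay/= Sw.
  by rewrite subr_ge0 leNgt yj.
rewrite /skellam_tail -/Ay; apply: (@lt_le_trans _ _ (pr (Ay `|` E))).
  by rewrite AyE ltrDl.
apply: pr_le; [exact: measurableU|exact: (skellam_tail_measurable pN pM)|].
move=> w [|/SE Sw] /=; last by rewrite Sw subrr.
by rewrite /Ay/=; move: yj; lra.
Qed.

(** The derivative is [- beta * D t], with [D] the second difference in space: Kolmogorov's backward
    equation. The Lipschitz bound makes it continuous. *)
Lemma skellam_tail_C1 (f : R -> R) y :
  (forall t, 0 <= t <= 1 -> f t = skellam_tail P N M y t) -> C1_on01 f.
Proof.
move=> fE; pose q := skellam_tail P N M.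
pose D t := q (y + 1) t + q (y - 1) t - 2 * q y t.
have D_lip s t : 0 <= s -> s <= t -> t <= 1 ->
    `|D s - D t| <= 8 * (beta * (t - s)).
  move=> s0 st t1.
  have := skellam_tail_lipschitz beta0 pN pM (y + 1) s0 st t1.
  have := skellam_tail_lipschitz beta0 pN pM (y - 1) s0 st t1.
  have := skellam_tail_lipschitz beta0 pN pM y s0 st t1.
  rewrite -/q /D !ler_norml => /andP[? ?] /andP[? ?] /andP[? ?].
  by apply/andP; split; lra.
have D_lip' s t : 0 <= s <= 1 -> 0 <= t <= 1 ->
    `|D s - D t| <= 8 * (beta * `|t - s|).
  move=> /andP[s0 s1] /andP[t0 t1]; have [st|/ltW ts] := leP s t.
    by rewrite [X in _ * (_ * X)]ger0_norm ?subr_ge0//; exact: D_lip.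
  rewrite distrC [`|t - s|]distrC [X in _ * (_ * X)]ger0_norm ?subr_ge0//.
  exact: D_lip.
(* [skellam_tail_expand] involves [D] at the later of the two times. If that is [t], the constant 12
   suffices; if it is [s], moving [D] to [t] costs 8 more, whence 20. *)
have f_lim s t : 0 <= s <= 1 -> 0 <= t <= 1 -> s != t ->
    `|- beta * D t - (f s - f t) / (s - t)| <= 20 * beta ^+ 2 * `|s - t|.
  move=> s01 t01; have /andP[s0 s1] := s01; have /andP[t0 t1] := t01.
  have Dst := D_lip' _ _ s01 t01.
  have b2 : 0 <= beta ^+ 2 by exact: sqr_ge0.
  rewrite !fE// -/q neq_lt => /orP[st|ts].
    have := skellam_tail_expand beta0 pN pM NM y s0 st t1; rewrite -/q -/(D t).
    set r := _ - _ - _ => rb.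
    have -> : - beta * D t - (q y s - q y t) / (s - t) = r / (t - s).
      by rewrite /r; field; apply/andP; split; apply/eqP; lra.
    have ts0 : 0 < t - s by rewrite subr_gt0.
    rewrite normrM normfV (gtr0_norm ts0) ler_pdivrMr// (distrC s) (gtr0_norm ts0).
    by apply: (le_trans rb); have := sqr_ge0 (beta * (t - s)); lra.
  have := skellam_tail_expand beta0 pN pM NM y t0 ts s1; rewrite -/q -/(D s).
  set r := _ - _ - _ => rb.
  have -> : - beta * D t - (q y s - q y t) / (s - t) =
      beta * (D s - D t) + r / (s - t).
    by rewrite /r; field; apply/eqP; lra.
  have ts0 : 0 < s - t by rewrite subr_gt0.
  apply: (le_trans (ler_normD _ _)).
  have -> : 20 * beta ^+ 2 * `|s - t| =
    8 * beta ^+ 2 * `|s - t| + 12 * beta ^+ 2 * `|s - t| by ring.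
  apply: lerD.
    rewrite normrM (gtr0_norm beta0) distrC (distrC s).
    have -> : 8 * beta ^+ 2 * `|t - s| = beta * (8 * (beta * `|t - s|)) by ring.
    by rewrite ler_wpM2l ?(ltW beta0)// distrC.
  rewrite normrM normfV (gtr0_norm ts0) ler_pdivrMr//.
  by apply: (le_trans rb); have := sqr_ge0 (beta * (s - t)); lra.
exists (fun t => - beta * D t).
  apply/subspace_continuousP => t /=; rewrite in_itv/= => t01.
  apply/cvgrPdist_lt => e e0; rewrite near_withinE.
  apply/nbhs_ballP; exists (e / (8 * beta ^+ 2 + 1)) => /=.
    by rewrite divr_gt0// ltr_pwDr// mulr_ge0// sqr_ge0.
  move=> s /= ts; rewrite /= in_itv/= => s01.
  rewrite -mulrBr normrM normrN (gtr0_norm beta0).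
  have := D_lip' _ _ t01 s01.
  move: ts; rewrite /ball/= distrC ltr_pdivlMr; last by rewrite ltr_pwDr// mulr_ge0// sqr_ge0.
  move=> te /(ler_wpM2l (ltW beta0)) Dts.
  apply: (le_lt_trans Dts); apply: le_lt_trans te.
  have := normr_ge0 (s - t); set z := `|s - t| => z0.
  have -> : beta * (8 * (beta * z)) = z * (8 * beta ^+ 2) by ring.
  by rewrite ler_wpM2l// lerDl.
move=> t t01; apply/cvgrPdist_lt => e e0; rewrite !near_withinE.
apply/nbhs_ballP; exists (e / (20 * beta ^+ 2 + 1)) => /=.
  by rewrite divr_gt0// ltr_pwDr// mulr_ge0// sqr_ge0.
move=> s /= ts; rewrite /= in_itv/= => st s01.
apply: (le_lt_trans (f_lim _ _ s01 t01 st)).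
move: ts; rewrite /ball/= distrC ltr_pdivlMr; last by rewrite ltr_pwDr// mulr_ge0// sqr_ge0.
apply: le_lt_trans; have := normr_ge0 (s - t); set z := `|s - t| => z0.
by rewrite mulrC ler_wpM2l// lerDl.
Qed.

End Law.

(** Both sides are the series of [skellam_sum]; for [s = t] both increments vanish. *)
Lemma skellam_law N M N' M' s t (B : set R) :
  poisson_process P beta N -> poisson_process P beta M ->
  poisson_process P beta N' -> poisson_process P beta M' ->
  indep P (natural_filtration N 1) (natural_filtration M 1) ->
  indep P (natural_filtration N' 1) (natural_filtration M' 1) ->
  0 <= s -> s <= t -> t <= 1 -> measurable B ->
  P (skellam N M s t @^-1` B) = P (skellam N' M' s t @^-1` B).
Proof.
move=> pN pM pN' pM' NM NM' s0; rewrite le_eqVlt => /predU1P[->|st] t1 mB.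
  congr (P _); apply/seteqP.
  by split=> w; rewrite /preimage/= /skellam /incr !subrr.
by rewrite !skellam_sum.
Qed.

End PricingRule.

Section Market.
Context {R : realType} {d : measure_display} {T : measurableType d}.
Variables (P : probability T R) (FF : R -> set (set T)) (delta beta : R).
Variables (v : T -> R) (ZB ZS : R -> T -> R).
Hypotheses (delta0 : 0 < delta) (beta0 : 0 < beta).
Hypothesis mkt : market P delta beta v ZB ZS FF.

Let N : R -> T -> R := fun t w => ZB t w / delta.
Let M : R -> T -> R := fun t w => ZS t w / delta.
Let pN : poisson_process P beta N := market_poisson_buy mkt.
Let pM : poisson_process P beta M := market_poisson_sell mkt.

Lemma natural_scale (V : R -> T -> R) t :
  natural_filtration (fun t w => V t w / delta) t `<=` natural_filtration V t.
Proof.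
apply: natural_sub; first exact: smallest_sigma_algebra.
move=> s s0 st; apply: subset_trans (natural_adapted (N := V) s0 st).
by apply: (sigma_rv_comp (g := fun x => x / delta)); exact: measurable_funM.
Qed.

Lemma market_indep : indep P (natural_filtration N 1) (natural_filtration M 1).
Proof. by apply: indepS (market_noise_indep mkt); exact: natural_scale. Qed.

Lemma noiseE t w : noise ZB ZS t w = delta * (N t w - M t w).
Proof. by rewrite /noise /N /M; field; rewrite gt_eqF. Qed.

Lemma noise_incr t w :
  noise ZB ZS 1 w - noise ZB ZS t w = delta * skellam N M t 1 w.
Proof. by rewrite !noiseE /skellam /incr; ring. Qed.

Lemma noise_natural_past t : natural_filtration (noise ZB ZS) t `<=` past N M t.
Proof.
apply: natural_sub; first exact: smallest_sigma_algebra.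
move=> s s0 st; rewrite (_ : noise ZB ZS s = fun w => delta * (N s w - M s w)).
  apply: sigma_rv_scale; apply: sigma_rv_subB; first exact: smallest_sigma_algebra.
    by move=> A hA; apply: sub_sigma_algebra; left; exact: natural_adapted hA.
  by move=> A hA; apply: sub_sigma_algebra; right; exact: natural_adapted hA.
by apply/funext => w; exact: noiseE.
Qed.

Lemma skellam_tail_event N' M' (z y t : R) :
  [set w : T | z <= y + delta * skellam N' M' t 1 w] =
  [set w | 0 <= (y - z) / delta + skellam N' M' t 1 w].
Proof.
apply/seteqP; split=> w /=; move: (skellam _ _ _ _ _) => S;
  rewrite -(pmulr_rge0 ((y - z) / delta + _) delta0) mulrDr mulrCA divff ?gt_eqF//; lra.
Qed.

Lemma tail_event (z y t : R) : [set w | z <= y + (noise ZB ZS 1 w - noise ZB ZS t w)] =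
  [set w | 0 <= (y - z) / delta + skellam N M t 1 w].
Proof. by under eq_set do rewrite noise_incr; exact: skellam_tail_event. Qed.

(** If [Z_t = y] has positive probability, it belongs to the past of [t] and the increment is
    independent of it, so its probability cancels. Otherwise the formula is the first branch of
    [bridge_price]. *)
Lemma bridge_priceE z y t : 0 <= t <= 1 ->
  bridge_price P ZB ZS z y t = skellam_tail P N M ((y - z) / delta) t.
Proof.
move=> /andP[t0 t1]; rewrite /bridge_price; case: ifPn => [_|E0].
  by rewrite tail_event.
set E := [set w | noise ZB ZS t w = y] in E0 *.
have pE : past N M t E.
  apply: noise_natural_past; apply: (natural_adapted (N := noise ZB ZS) t0 (lexx t)).
  exact: (sigma_rv_preimage (noise ZB ZS t) (measurable_set1 y)).
have mE : measurable E by apply: (past_measurable pN pM t1).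
rewrite (_ : _ `&` E = E `&` [set w | 0 <= (y - z) / delta + skellam N M t 1 w]).
  rewrite (pr_indep (past_measurable pN pM t1) _
    (past_indep pN pM market_indep t0 t1 (lexx 1)) pE (skellam_tail_sigma _ _ _ _)).
    rewrite mulrAC divff ?mul1r//; apply: contra E0 => /eqP E0.
    by rewrite (prE P mE) E0.
  by apply/sigma_rv_measurable => _ B mB; rewrite setTI; exact: (skellam_measurable pN pM).
rewrite -tail_event setIC; apply/seteqP; split=> w [Ew] /=.
  by rewrite -{1}Ew addrC subrK.
by rewrite -{1}Ew addrC subrK.
Qed.

Lemma grid_div y : grid delta y -> exists j : int, y / delta = j%:~R.
Proof. by move=> [j ->]; exists j; rewrite mulfK// gt_eqF. Qed.

Lemma bridge_pricing_rule (p : R -> R -> R) (z : R) : grid delta z ->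
  (forall y t, grid delta y -> 0 <= t <= 1 -> 0 <= p y t <= 1) ->
  (forall y t, grid delta y -> 0 <= t <= 1 ->
     p y t = bridge_price P ZB ZS z y t) ->
  pricing_rule delta p.
Proof.
move=> gz p01 pE; split=> // [y y' t gy gy' /andP[t0 t1] yy'|y gy].
  have t01 : 0 <= t <= 1 by rewrite t0 ltW.
  rewrite !pE// !bridge_priceE//.
  have [j' y'E] := grid_div gy'; have [k zE] := grid_div gz.
  rewrite [X in _ < skellam_tail _ _ _ X _](_ : _ = (j' - k)%:~R); last first.
    by rewrite mulrBl y'E zE rmorphB.
  apply: (skellam_tail_increasing beta0 pN pM market_indep) => //.
  by rewrite rmorphB/= -y'E -zE -mulrBl ltr_pM2r ?invr_gt0// ltrD2r.
apply: (skellam_tail_C1 beta0 pN pM market_indep (y := (y - z) / delta)) => t t01.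
by rewrite pE// bridge_priceE.
Qed.

End Market.
(** * Rationality of the bridge price *)

Section Freezing.
Context {R : realType} {d : measure_display} {T : measurableType d}.
Variable P : probability T R.
Implicit Types (F G : set (set T)) (X Y eta : T -> R) (A : set T).

Local Notation pr A := (fine (P A)).

Lemma countable_grid (c : R) : countable (grid c).
Proof.
have -> : grid c = [set k%:~R * c | k in [set: int]].
  by apply/seteqP; split=> [y [k ->]|y [k _ <-]]; exists k.
by apply: sub_countable (card_image_le _ _) _.
Qed.

(** Every subset of the grid is countable, hence Borel, so [f] can be arbitrary. It is applied to
    prices, which are constrained only on the grid. *)
Lemma grid_sigma (c : R) Y (f : R -> R) : (forall w, grid c (Y w)) ->
  sigma_rv (f \o Y) `<=` sigma_rv Y.
Proof.
move=> gY _ [B mB <-]; exists (grid c `&` f @^-1` B).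
  apply: countable_measurable; first exact: measurable_set1.
  by apply: sub_countable (countable_grid c); apply: subset_card_le; exact: subIsetl.
by apply/seteqP; split=> w /=; [case=> _ []|case=> _ fB; split].
Qed.

Lemma bounded_integrable (f : T -> R) (K : R) A : measurable A ->
  measurable_fun setT f -> (forall w, `|f w| <= K) -> P.-integrable A (EFin \o f).
Proof.
move=> mA mf fK; apply: measurable_bounded_integrable => //.
- by rewrite ltey_eq fin_num_measure.
- exact: measurable_funTS.
- exists K; split; first exact: num_real.
  by move=> y Ky w _; apply: le_trans (fK w) _; exact: ltW.
Qed.

Lemma integral_freeze_const E D (x : R) : measurable E -> measurable D ->
  P (E `&` D) = (P E * P D)%E ->
  (\int[P]_(w in E) (x * (\1_D w - pr D))%:E = 0)%E.
Proof.
move=> mE mD ED.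
under eq_integral do rewrite mulrBr EFinB.
have iD : P.-integrable E (EFin \o (\1_D : T -> R)).
  by apply: integrableS (integrable_indic P mD).
rewrite integralB_EFin//.
- under [X in (X - _)%E]eq_integral do rewrite EFinM.
  have -> : (\int[P]_(w in E) (x * pr D)%:E = (x * pr D)%:E * P E)%E.
    exact: integral_cst.
  rewrite integralZl//.
  have -> : (\int[P]_(w in E) (\1_D w)%:E = P (E `&` D))%E.
    by rewrite setIC integral_indic.
  rewrite ED.
  by rewrite (prE P mE) (prE P mD) -!EFinM -EFinB; congr EFin; ring.
- under [X in _.-integrable _ X]eq_fun do rewrite /= EFinM.
  exact: integrableZl.
- exact: finite_measure_integrable_cst.
Qed.

(** Given [G], the variables [X] and [Y] are constants and [eta] keeps its law. Lattice values make
    this concrete: [A] is cut into countably many pieces of [G] on which [X] and [Y] are constant,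
    and [integral_freeze_const] settles each piece. *)
Lemma integral_freeze (c c' z : R) G X Y eta A :
  0 < c -> 0 < c' ->
  sigma_algebra setT G -> G `<=` measurable ->
  sigma_rv X `<=` G -> sigma_rv Y `<=` G -> G A ->
  measurable_fun setT eta -> indep P G (sigma_rv eta) ->
  (forall w, grid c (X w)) -> (forall w, grid c' (Y w)) ->
  P.-integrable setT (EFin \o X) ->
  let H := fun w => X w * (\1_[set w | z <= Y w + eta w] w -
                           pr [set w' | z <= Y w + eta w']) in
  P.-integrable A (EFin \o H) /\ (\int[P]_(w in A) (H w)%:E = 0)%E.
Proof.
move=> c0 c'0 sG mG XG YG GA meta Geta gX gY iX; set H := fun w => _.
rewrite /=; have mA := mG _ GA.
have mX : measurable_fun setT X by apply/sigma_rv_measurable => B /XG/mG.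
have mY : measurable_fun setT Y by apply/sigma_rv_measurable => B /YG/mG.
have mle (V : T -> R) : measurable_fun setT V -> measurable [set w | z <= V w].
  move=> mV; rewrite [X in measurable X](_ : _ = V @^-1` `[z, +oo[); last first.
    by apply/seteqP; split=> w /=; rewrite in_itv/= andbT.
  by rewrite -[X in measurable X]setTI; exact: mV.
have mS : measurable [set w | z <= Y w + eta w].
  by apply: (mle (fun w => Y w + eta w)); exact: measurable_funD.
have mSy y : measurable [set w | z <= y + eta w].
  by apply: (mle (fun w => y + eta w)); exact: measurable_funD.
pose phi y := pr [set w' | z <= y + eta w'].
have mphi : measurable_fun setT (phi \o Y).
  by apply/sigma_rv_measurable => B /(grid_sigma gY)/YG/mG.
have mH : measurable_fun setT H.
  by apply: measurable_funM => //; apply: measurable_funB => //; exact: measurable_indic.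
(* The factor multiplying [X] lies in [-1, 1], so [X] dominates. *)
have iH : P.-integrable setT (EFin \o H).
  apply: (le_integrable _ _ _ iX) => //; first exact/measurable_EFinP.
  move=> w _ /=; rewrite lee_fin normrM ler_piMr// /H.
  have := pr_ge0 P [set w' | z <= Y w + eta w'].
  have := pr_le1 P (mSy (Y w)); rewrite indicE.
  by case: (w \in _) => /= ? ?; rewrite ler_norml; apply/andP; split; lra.
have iHA : P.-integrable A (EFin \o H) by exact: integrableS iH.
split=> //.
(* The two lattice indices merged into one natural number, whose fibres are the pieces. *)
pose code w := pickle (Num.floor (X w / c), Num.floor (Y w / c')).
have codeX w w' : code w = code w' -> X w = X w' /\ Y w = Y w'.
  move=> /(pcan_inj (@pickleK _)) [].
  have [k ->] := gX w; have [l ->] := gX w'; have [k' ->] := gY w.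
  have [l' ->] := gY w'; rewrite !mulfK ?gt_eqF//.
  by rewrite !intrKfloor => -> ->.
pose E n := A `&` code @^-1` [set n].
have EG n w : E n w -> E n = A `&` (X @^-1` [set X w] `&` Y @^-1` [set Y w]).
  move=> [_ /= wn]; apply/seteqP; split=> u [Au] /=.
    by rewrite -wn => /codeX[-> ->].
  by move=> [Xu Yu]; split=> //=; rewrite -wn /code Xu Yu.
have GE n w : E n w -> G (E n).
  move=> /EG ->; apply: sigma_setI => //; apply: sigma_setI => //.
    by apply: XG; exact: sigma_rv_preimage.
  by apply: YG; exact: sigma_rv_preimage.
have mE n : measurable (E n).
  have [->//|/set0P[w Ew]] := eqVneq (E n) set0.
  by apply: mG; exact: GE Ew.
have AE : A = \bigcup_n E n.
  by apply/seteqP; split=> [w Aw|w [n _ []]//]; exists (code w).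
rewrite AE in iHA *; rewrite integral_bigcup//; last first.
  by apply: trivIset_setIl => i j _ _ [w [/= <- <-]].
apply: eseries0 => n _ _.
have [->|/set0P[w Ew]] := eqVneq (E n) set0; first by rewrite integral_set0.
rewrite -(@integral_freeze_const (E n) [set w' | z <= Y w + eta w'] (X w))//.
  apply: eq_integral => u /set_mem; rewrite (EG _ _ Ew) => -[_ [/= Xu Yu]].
  rewrite /H Xu Yu !indicE; congr (X w * (_%:R - _))%:E; congr nat_of_bool.
  by apply/idP/idP => /set_mem/= h; apply/mem_set; rewrite /= ?Yu// -Yu.
apply: Geta; first exact: GE Ew.
rewrite [X in sigma_rv _ X](_ : _ = eta @^-1` `[z - Y w, +oo[).
  exact: sigma_rv_preimage.
by apply/seteqP; split=> u /=; rewrite in_itv/= andbT; lra.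
Qed.

End Freezing.

(** * The augmented past of a Poisson pair *)

Section CompletedPast.
Context {R : realType} {d : measure_display} {T : measurableType d}.
Variables (P : probability T R) (beta : R).
Hypothesis beta0 : 0 < beta.
Hypothesis negligible_measurable : P.-negligible `<=` measurable.
Variables N M : R -> T -> R.
Hypotheses (pN : poisson_process P beta N) (pM : poisson_process P beta M).
Hypothesis NM : indep P (natural_filtration N 1) (natural_filtration M 1).

Local Notation pr A := (fine (P A)).

Definition completed_past t : set (set T) := <<s past N M t `|` P.-negligible >>.

Lemma completed_past_le s t : s <= t -> completed_past s `<=` completed_past t.
Proof. by move=> st; apply: sub_sigma_algebra2; apply: setSU; exact: past_le. Qed.

Lemma completed_past_measurable t : t <= 1 -> completed_past t `<=` measurable.
Proof.
move=> t1; apply: generated_measurable => A [|/negligible_measurable//].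
exact: (past_measurable pN pM t1).
Qed.

(** Past events and null events together form a pi-system, since meeting a null set gives a null
    set, and null events are independent of everything. *)
Lemma completed_past_indep t : 0 <= t -> t <= 1 ->
  indep P (completed_past t) (sigma_rv (skellam N M t 1)).
Proof.
move=> t0 t1.
have mS : sigma_rv (skellam N M t 1) `<=` measurable.
  apply/sigma_rv_measurable => _ B mB.
  by rewrite setTI; exact: (skellam_measurable pN pM).
have mP := past_measurable pN pM t1.
apply: indep_generatedl => //.
- move=> A B [pA|nA] [pB|nB]; [left|right..].
  + exact: (sigma_setI (smallest_sigma_algebra _ _)).
  + exact: negligibleS nB.
  + exact: negligibleS nA.
  + exact: negligibleS nA.
- by move=> A [/mP//|/negligible_measurable].
- move=> A B [pA|nA] SB; first exact: (past_indep pN pM NM t0 t1 (lexx 1)).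
  by rewrite (measure_negligible _ nA) ?mul0e ?measure_negligible//;
    do ?[exact: negligible_measurable | exact: negligibleS nA |
         apply: measurableI; [exact: negligible_measurable|exact: mS]].
Qed.

Lemma completed_past_ae t A A' (C : set T) : P.-negligible C -> past N M t A' ->
  (forall w, ~ C w -> A w <-> A' w) -> completed_past t A.
Proof.
move=> nC pA' AA'; have sC : sigma_algebra setT (completed_past t).
  exact: smallest_sigma_algebra.
have -> : A = (A' `\` C) `|` (A `&` C).
  apply/seteqP; split=> w.
    by have [Cw|nCw] := pselect (C w); [right|left; split => //; apply/AA'].
  by move=> [[A'w nCw]|[]//]; apply/AA'.
apply: (sigma_setU sC); first apply: (sigma_setD sC).
- by apply: sub_sigma_algebra; left.
- by apply: sub_sigma_algebra; right.
- by apply: sub_sigma_algebra; right; exact: negligibleS nC.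
Qed.

(* The constraint at time 1 only matters for t = 1, where ]t, 1] is empty. *)
Definition usual_past t : set (set T) :=
  completed_past 1 `&` \bigcap_(s in `]t, 1]) completed_past s.

Lemma completed_usual t : t <= 1 -> completed_past t `<=` usual_past t.
Proof.
move=> t1 A At; split; first exact: completed_past_le At.
by move=> s /=; rewrite in_itv/= => /andP[/ltW ts _]; exact: completed_past_le At.
Qed.

Lemma usual_past_usual : usual_filtration P usual_past.
Proof.
have sC s : sigma_algebra setT (completed_past s) by exact: smallest_sigma_algebra.
split; [split|..].
- move=> t _; have -> : usual_past t =
      \bigcap_(s in [set 1] `|` `]t, 1]) completed_past s.
    by rewrite bigcap_setU bigcap_set1.
  by apply: sigma_algebra_bigcap => s _; exact: sC.
- by move=> t _ A [A1 _]; exact: completed_past_measurable A1.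
- move=> s t _ st _ A [A1 As]; split => // u /=.
  rewrite in_itv/= => /andP[tu u1]; apply: As.
  by rewrite /= in_itv/= u1 (le_lt_trans st).
- move=> A nA; apply: completed_usual; first exact: ler01.
  by apply: sub_sigma_algebra; right.
- move=> t /andP[t0 t1] A At; split.
    by have [] : usual_past 1 A by apply: At; rewrite /= in_itv/= t1 lexx.
  move=> s /=; rewrite in_itv/= => /andP[ts s1].
  have [mt ms] := midf_lt ts.
  have [_] : usual_past ((t + s) / 2) A.
    by apply: At; rewrite /= in_itv/= mt (le_trans (ltW ms)).
  by apply; rewrite /= in_itv/= ms.
Qed.

(** For every s > t the event [A] is independent of the increment over ]s, 1]. Passing to the
    increment over ]t, 1] costs at most twice 2 beta (s - t), which vanishes as s decreases to t. *)
Lemma usual_past_indep t : 0 <= t -> t <= 1 ->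
  indep P (usual_past t) (sigma_rv (skellam N M t 1)).
Proof.
move=> t0; rewrite le_eqVlt => /predU1P[->|t1] A D.
  by move=> [A1 _]; exact: completed_past_indep.
have t_1 := ltW t1.
move=> [A1 At] [B mB <-]; rewrite setTI.
have mA : measurable A by exact: completed_past_measurable A1.
have mS s : 0 <= s -> s <= 1 -> measurable (skellam N M s 1 @^-1` B).
  by move=> s0 s1; exact: (skellam_measurable pN pM).
have mD := mS _ t0 t_1.
set D' := skellam N M t 1 @^-1` B in mD *.
have mAD : measurable (A `&` D') by exact: measurableI.
rewrite (prE P mAD) (prE P mA) (prE P mD) -EFinM; congr EFin.
have bound s : t < s -> s <= 1 ->
    `|pr (A `&` D') - pr A * pr D'| <= 4 * beta * (s - t).
  move=> ts s1; have s0 := le_trans t0 (ltW ts).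
  have mDs := mS _ s0 s1; set Ds := skellam N M s 1 @^-1` B in mDs.
  have As : completed_past s A by apply: At; rewrite /= in_itv/= ts.
  have ADs : pr (A `&` Ds) = pr A * pr Ds.
    rewrite (completed_past_indep s0 s1 As) ?fineM ?fin_num_measure//.
    exact: sigma_rv_preimage.
  have ne := pr_skellam_neq0 beta0 pN pM t0 (ltW ts) s1.
  have mne : measurable (~` (skellam N M t s @^-1` [set 0])).
    by apply: measurableC; exact: (skellam_measurable pN pM t0 (ltW ts) s1).
  have DDs w : ~ (~` (skellam N M t s @^-1` [set 0])) w -> D' w <-> Ds w.
    by move=> /contrapT/= S0; rewrite /D' /Ds /= (skellamD _ _ t s) S0 add0r.
  have d1 := pr_dist P mD mDs mne DDs.
  have d2 : `|pr (A `&` D') - pr (A `&` Ds)| <= _ :=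
    pr_dist P mAD (measurableI _ _ mA mDs) mne
      (fun w nw => and_iff_compat_l (A w) (DDs w nw)).
  have -> : pr (A `&` D') - pr A * pr D' =
    (pr (A `&` D') - pr (A `&` Ds)) + pr A * (pr Ds - pr D') by rewrite ADs; ring.
  apply: (le_trans (ler_normD _ _)).
  have : `|pr A * (pr Ds - pr D')| <= `|pr D' - pr Ds|.
    rewrite normrM distrC (ger0_norm (pr_ge0 _ _)) ler_piMl//.
    exact: pr_le1.
  move: d1 d2 ne; lra.
apply/eqP; rewrite -subr_eq0 -normr_eq0; apply: contraT => x0.
have {}x0 : 0 < `|pr (A `&` D') - pr A * pr D'| by rewrite lt_def x0/=.
move: x0 bound; set x := `|_| => x0 bound.
have b4 : 0 < 4 * beta by rewrite mulr_gt0.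
(* A step of x / (4 beta + 1) makes the bound smaller than [x]; if it leads beyond 1, then s = 1 is
   already close enough. *)
have [xs|xs] := leP (t + x / (4 * beta + 1)) 1.
  have e0 : 0 < x / (4 * beta + 1) by rewrite divr_gt0// addr_gt0.
  have ts : t < t + x / (4 * beta + 1) by rewrite ltrDl.
  have := bound _ ts xs.
  rewrite (addrC t) addrK leNgt => /negP[].
  by rewrite mulrA ltr_pdivrMr ?addr_gt0//; lra.
have := bound _ t1 (lexx 1); rewrite leNgt => /negP[].
have : 1 - t < x / (4 * beta + 1) by rewrite ltrBlDl.
by rewrite ltr_pdivlMr ?addr_gt0//; lra.
Qed.

End CompletedPast.

Section RationalPricing.
Context {R : realType} {d : measure_display} {T : measurableType d}.
Variables (P : probability T R) (FF : R -> set (set T)) (delta beta : R).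
Variables (v : T -> R) (ZB ZS : R -> T -> R).
Hypotheses (delta0 : 0 < delta) (beta0 : 0 < beta).
Hypothesis mkt : market P delta beta v ZB ZS FF.

Local Notation pr A := (fine (P A)).
Let N : R -> T -> R := fun t w => ZB t w / delta.
Let M : R -> T -> R := fun t w => ZS t w / delta.

(** Completeness of [FF] passes to the ambient sigma-algebra, so completed filtrations contain only
    measurable events. *)
Lemma market_negligible_measurable : P.-negligible `<=` measurable.
Proof.
have t01 : 0 <= (0 : R) <= 1 by rewrite lexx/= ler01.
move=> A /(usual_complete (market_usual mkt)).
exact: (filtration_measurable (usual_is_filtration (market_usual mkt)) t01).
Qed.

Lemma point_path_grid (x : R -> R) t : point_path delta x -> 0 <= t <= 1 ->
  grid delta (x t).
Proof.
move=> xP t01; have [n ->] := point_path_lattice xP t01.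
by exists n; rewrite -pmulrn mulr_natl.
Qed.

Lemma gridB a b : grid delta a -> grid delta b -> grid delta (a - b).
Proof. by move=> [j ->] [k ->]; exists (j - k); rewrite rmorphB mulrBl. Qed.

Lemma gridD a b : grid delta a -> grid delta b -> grid delta (a + b).
Proof. by move=> [j ->] [k ->]; exists (j + k); rewrite rmorphD mulrDl. Qed.

Lemma noise_grid t w : 0 <= t <= 1 -> grid delta (noise ZB ZS t w).
Proof.
move=> t01.
have [n nE] := point_path_lattice (poisson_path (market_poisson_buy mkt) w) t01.
have [m mE] := point_path_lattice (poisson_path (market_poisson_sell mkt) w) t01.
apply: gridB; [exists n|exists m].
  by rewrite -pmulrn -nE divfK ?gt_eqF.
by rewrite -pmulrn -mE divfK ?gt_eqF.
Qed.

Lemma demand_grid XB XS FI t w : admissible P delta v ZB ZS XB XS FI ->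
  0 <= t <= 1 -> grid delta (total_demand ZB ZS XB XS t w).
Proof.
move=> adm t01; have [pB pS] := admissible_path adm w.
apply: gridD; first exact: noise_grid.
by apply: gridB; [exact: (point_path_grid pB)|exact: (point_path_grid pS)].
Qed.

Lemma value_bound w : `|v w| <= 1.
Proof. by case: (market_value mkt w) => ->; rewrite ?normr0 ?normr1. Qed.

Lemma bridge_rational (p : R -> R -> R) (z : R) XB XS FI :
  pricing_rule delta p ->
  (forall y t, grid delta y -> 0 <= t <= 1 ->
     p y t = bridge_price P ZB ZS z y t) ->
  {ae P, forall w, (z <= total_demand ZB ZS XB XS 1 w) <-> (v w = 1)} ->
  inconspicuous P delta beta v ZB ZS XB XS FI ->
  rational_pricing P delta v ZB ZS p XB XS.
Proof.
move=> pp pE [C1 [mC1 PC1 zv]] inc; split=> //.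
have adm := inconspicuous_admissible inc.
have [YB [YS [[C2 [mC2 PC2 YE]] [pYB pYS] iY _]]] := inconspicuous_demand inc.
set Y := total_demand ZB ZS XB XS in zv YE *.
pose N' : R -> T -> R := fun t w => YB t w / delta.
pose M' : R -> T -> R := fun t w => YS t w / delta.
have iNM : indep P (natural_filtration N' 1) (natural_filtration M' 1).
  by apply: indepS iY; exact: natural_scale.
have negm := market_negligible_measurable.
have sY t w : YB t w - YS t w = delta * (N' t w - M' t w).
  by rewrite /N' /M'; field; rewrite gt_eqF.
have {}YE t w : 0 <= t <= 1 -> ~ C2 w -> Y t w = delta * (N' t w - M' t w).
  by move=> t01 nw; rewrite -sY; apply: contrapT => h; apply/nw/YE => /(_ t t01).
have {}zv w : ~ C1 w -> (z <= Y 1 w) <-> (v w = 1).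
  by move=> nw; apply: contrapT => h; apply/nw/zv.
have nC1 : P.-negligible C1 by apply/negligibleP.
have nC2 : P.-negligible C2 by apply/negligibleP.
(* Demand equals [YB - YS] only off a null set, so adaptedness relies on the null events of the
   completed past. *)
have aY : adapted (usual_past P N' M') Y.
  move=> t /andP[t0 t1] _ [B mB <-]; apply: completed_usual => //.
  apply: (completed_past_ae (A' := (fun w => delta * (N' t w - M' t w)) @^-1` B) nC2).
    have : sigma_rv (fun w => delta * (N' t w - M' t w)) `<=` past N' M' t.
      apply: sigma_rv_scale; apply: sigma_rv_subB; first exact: smallest_sigma_algebra.
        by move=> A hA; apply: sub_sigma_algebra; left; exact: natural_adapted hA.
      by move=> A hA; apply: sub_sigma_algebra; right; exact: natural_adapted hA.
    by apply; exact: sigma_rv_preimage.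
  by move=> w nw; rewrite setTI /preimage/= YE// t0.
have uY := usual_past_usual negm pYB pYS.
move=> t t01; have /andP[t0 t1] := t01.
(* The minimal filtration lies below every usual filtration that [Y] is adapted to; this one is
   independent of the future increment, which makes freezing possible. *)
have minY : minimal_filtration P Y t `<=` usual_past P N' M' t.
  by move=> A; apply.
have mU : usual_past P N' M' t `<=` measurable.
  exact: (filtration_measurable (usual_is_filtration uY)).
have gY w : grid delta (Y t w) by exact: demand_grid adm t01.
have mY : measurable_fun setT (Y t).
  by apply/sigma_rv_measurable => B /(aY _ t01)/mU.
have mW : measurable_fun setT (fun w => p (Y t w) t).
  apply/sigma_rv_measurable => B /(grid_sigma (f := fun y => p y t) gY).
  by move=> /(aY _ t01)/mU.
have Wb w : `|p (Y t w) t| <= 1.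
  have /andP[p0 p1] := pricing_range pp (gY w) t01.
  by rewrite ger0_norm.
have iW A : measurable A -> P.-integrable A (EFin \o (fun w => p (Y t w) t)).
  by move=> mA; exact: bounded_integrable Wb.
have iv A : measurable A -> P.-integrable A (EFin \o v).
  move=> mA; apply: bounded_integrable value_bound => //.
  exact: market_value_measurable mkt.
split; [exact: iv|exact: iW|..].
- move=> B hB F uF aF.
  by apply: (aF _ t01); exact: (grid_sigma (f := fun y => p y t) gY).
- move=> A /minY UA; have mA := mU _ UA.
  pose eta w := delta * skellam N' M' t 1 w.
  have seta : sigma_rv eta `<=` sigma_rv (skellam N' M' t 1) by exact: sigma_rv_scale.
  have meta : measurable_fun setT eta.
    apply/sigma_rv_measurable => B /seta [C mC <-]; rewrite setTI.
    exact: (skellam_measurable pYB pYS).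
  have g1 (w : T) : grid 1 ((fun=> 1) w : R) by exists 1; rewrite mulr1.
  have s1 : sigma_rv (fun=> 1 : R) `<=` usual_past P N' M' t.
    apply/sigma_rv_subP; last exact: measurable_cst.
    exact: (filtration_sigma_algebra (usual_is_filtration uY)).
  have [] := @integral_freeze _ _ _ P 1 delta z (usual_past P N' M' t) (fun=> 1)
    (Y t) eta A ltr01 delta0 (filtration_sigma_algebra (usual_is_filtration uY) t01)
    mU s1 (aY _ t01) UA meta
    (indepS (fun _ => id) seta (usual_past_indep beta0 negm pYB pYS iNM t0 t1))
    g1 gY (finite_measure_integrable_cst P 1 measurableT).
  set H := fun w => _; move=> iH H0.
  have pS w : pr [set w' | z <= Y t w + eta w'] = p (Y t w) t.
    rewrite pE// (bridge_priceE delta0 mkt)// /eta (skellam_tail_event delta0).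
    rewrite /skellam_tail; congr fine; rewrite !skellam_tail_set.
    apply: (skellam_law beta0 pYB pYS (market_poisson_buy mkt)
      (market_poisson_sell mkt) iNM (market_indep mkt)) => //.
  transitivity (\int[P]_(w in A) ((H w)%:E + (p (Y t w) t)%:E))%E.
    by rewrite integralD_EFin//; [rewrite H0 add0e|exact: iW].
  apply: ae_eq_integral => //.
  + apply/measurable_EFinP; apply: measurable_funD.
      by apply/measurable_EFinP; exact: measurable_int iH.
    exact: measurable_funTS.
  + by apply/measurable_EFinP/measurable_funTS; exact: market_value_measurable mkt.
  exists (C1 `|` C2); split; first exact: measurableU.
    by rewrite null_set_setU.
  move=> w /= hw; apply: contrapT => /not_orP[n1 n2]; apply: hw => Aw.
  rewrite -EFinD; congr EFin; rewrite /H mul1r pS subrK indicE.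
  have YE1 : Y t w + eta w = Y 1 w.
    rewrite !YE ?ler01 ?lexx// /eta /skellam /incr; ring.
  case: (market_value mkt w) => vw; rewrite vw; last first.
    by rewrite mem_set//= YE1; apply/zv.
  rewrite memNset//= YE1 => /(zv _ n1); rewrite vw => /eqP.
  by rewrite eq_sym oner_eq0.
Qed.

End RationalPricing.
(** * Profit along a path *)

Section RiemannAlgebra.
Context {R : realType}.
Implicit Types (f g x y : R -> R).

Lemma riemannB f x y n :
  riemann f (fun t => x t - y t) n = riemann f x n - riemann f y n.
Proof. by rewrite /riemann -sumrB; apply: eq_bigr => i _; ring. Qed.

Lemma riemann_telescope (psi : R -> R) f x n :
  (forall s t, 0 <= s -> s <= t -> t <= 1 ->
     f t * (x t - x s) <= psi (x s) - psi (x t)) ->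
  riemann f x n <= psi (x 0) - psi (x 1).
Proof.
move=> fpsi.
have -> : psi (x 0) - psi (x 1) =
    \sum_(i < n.+1) - (psi (x (mesh n i.+1)) - psi (x (mesh n i))).
  rewrite sumrN -(big_mkord xpredT (fun i => psi (x (mesh n i.+1)) - psi (x (mesh n i)))).
  by rewrite (telescope_sumr (fun i => psi (x (mesh n i)))) ?mesh0 ?mesh1 ?opprB.
apply: ler_sum => i _; rewrite opprB; apply: fpsi; last 2 first.
- exact: le_mesh.
- by have /andP[] := mesh_itv (R := R) (ltn_ord i).
- by have /andP[] := mesh_itv (R := R) (ltnW (ltn_ord i)).
Qed.

End RiemannAlgebra.

(** Recombines the three types of insider order, exactly one of which is present at each jump. *)
Lemma sum_trisect (R : nmodType) (I : eqType) (J : seq I) (c0 c1 c2 : pred I)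
  (f0 f1 f2 f : I -> R) :
  (forall s, s \in J -> (if c0 s then f0 s else 0) + (if c1 s then f1 s else 0) +
     (if c2 s then f2 s else 0) = f s) ->
  \sum_(s <- J | c0 s) f0 s + \sum_(s <- J | c1 s) f1 s + \sum_(s <- J | c2 s) f2 s =
  \sum_(s <- J) f s.
Proof.
move=> fE; rewrite (big_mkcond c0) (big_mkcond c1) (big_mkcond c2) -!big_split/=.
by rewrite big_seq [RHS]big_seq; apply: eq_bigr => s /fE.
Qed.

Section PathwiseProfit.
Context {R : realType} {d : measure_display} {T : measurableType d}.
Variables (delta : R) (v : T -> R) (ZB ZS XB XS : R -> T -> R).
Variables (p : R -> R -> R) (w : T).
Hypothesis delta0 : 0 < delta.
Variables JZB JZS JB JS : seq R.
Hypotheses (uZB : uniq JZB) (uZS : uniq JZS) (uB : uniq JB) (uS : uniq JS).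
Hypotheses (hZB : steps delta JZB (ZB ^~ w)) (hZS : steps delta JZS (ZS ^~ w)).
Hypotheses (hB : steps delta JB (XB ^~ w)) (hS : steps delta JS (XS ^~ w)).

Let Y := total_demand ZB ZS XB XS.
Let dx (J : seq R) s := if s \in J then delta else 0.

Lemma steps_jump_times J (Z : R -> T -> R) s : uniq J -> steps delta J (Z ^~ w) ->
  0 < s <= 1 -> (s \in jump_times (Z ^~ w)) = (s \in J).
Proof.
move=> uJ hJ s01; apply/idP/idP => [/set_mem|sJ].
  by rewrite /jump_times/= (steps_jump uJ hJ s01); case: ifP => //; rewrite eqxx.
by apply/mem_set; rewrite /jump_times/= (steps_jump uJ hJ s01) sJ gt_eqF.
Qed.

Lemma demand_left_lim s : 0 < s <= 1 ->
  left_lim (Y ^~ w) s = Y s w - (dx JZB s - dx JZS s + (dx JB s - dx JS s)).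
Proof.
move=> s01.
have -> : left_lim (Y ^~ w) s = left_lim (ZB ^~ w) s - left_lim (ZS ^~ w) s +
    (left_lim (XB ^~ w) s - left_lim (XS ^~ w) s).
  rewrite !(steps_left_lim hZB, steps_left_lim hZS, steps_left_lim hB,
    steps_left_lim hS)//.
  apply/cvg_lim => //; apply: cvgD; apply: cvgB; exact: steps_left_cvg.
have E Z J : uniq J -> steps delta J (Z ^~ w) ->
    left_lim (Z ^~ w) s = Z s w - dx J s.
  by move=> uJ hJ; rewrite /dx -(steps_jump uJ hJ s01) /jump opprB addrC subrK.
rewrite (E _ _ uZB hZB) (E _ _ uZS hZS) (E _ _ uB hB) (E _ _ uS hS).
by rewrite /Y /total_demand /noise; ring.
Qed.

Hypotheses (noZ : forall s, s \in JZB -> s \notin JZS).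
Hypotheses (noX : forall s, s \in JB -> s \notin JS).

(** Each of the six prices is taken at Y after the jump: the shifts by 0, delta and 2 delta are the
    jump of Y itself. A common jump of the two noise processes would count an order twice, and a
    common jump of [XB] and [XS] would change the shift. *)
Lemma profit_steps : profit delta v ZB ZS p XB XS w =
  \sum_(s <- JB) (v w - p (Y s w) s) * delta -
  \sum_(s <- JS) (v w - p (Y s w) s) * delta.
Proof.
rewrite /profit /XBB /XBT /XBS /XSS /XST /XSB.
have EJ (X : R -> T -> R) J D h : uniq J -> steps delta J (X ^~ w) ->
    point_integral h (jumps_in D (X ^~ w)) = \sum_(s <- J | s \in D) h s * delta.
  move=> uJ hJ; rewrite -big_filter.
  exact: steps_point_integral (filter_uniq _ uJ) (steps_jumps_in D uJ hJ).
rewrite 3!(EJ XB JB _ _ uB hB) 3!(EJ XS JS _ _ uS hS).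
set b0 := \sum_(s <- JB | _) _; set b1 := \sum_(s <- JB | _) _.
set b2 := \sum_(s <- JB | _) _; set s0 := \sum_(s <- JS | _) _.
set s1 := \sum_(s <- JS | _) _; set s2 := \sum_(s <- JS | _) _.
suff [<- <-] : b0 + b1 + b2 = \sum_(s <- JB) (v w - p (Y s w) s) * delta /\
    s0 + s1 + s2 = \sum_(s <- JS) (v w - p (Y s w) s) * delta by ring.
have inD (A B : set R) s : (s \in ~` (A `|` B)) = ~~ ((s \in A) || (s \in B)).
  by rewrite in_setC in_setU.
split; apply: sum_trisect => s sJ.
- have s01 := steps_itv hB sJ.
  rewrite !inD !(steps_jump_times uZB hZB s01) !(steps_jump_times uZS hZS s01).
  rewrite (demand_left_lim s01) /dx sJ (negbTE (noX sJ)).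
  case sZB : (s \in JZB); case sZS : (s \in JZS) => /=.
  + by have := noZ sZB; rewrite sZS.
  + by rewrite add0r addr0; congr ((_ - p _ _) * _); ring.
  + by rewrite !add0r; congr ((_ - p _ _) * _); ring.
  + by rewrite !addr0; congr ((_ - p _ _) * _); ring.
- have s01 := steps_itv hS sJ.
  rewrite !inD !(steps_jump_times uZB hZB s01) !(steps_jump_times uZS hZS s01).
  have sB : s \in JB = false by apply/negP => /noX; rewrite sJ.
  rewrite (demand_left_lim s01) /dx sJ sB.
  case sZB : (s \in JZB); case sZS : (s \in JZS) => /=.
  + by have := noZ sZB; rewrite sZS.
  + by rewrite !add0r; congr ((_ - p _ _) * _); ring.
  + by rewrite add0r addr0; congr ((_ - p _ _) * _); ring.
  + by rewrite !addr0; congr ((_ - p _ _) * _); ring.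
Qed.

Lemma demand_right_const s : 0 <= s -> exists2 r : R, 0 < r &
  forall t, s <= t -> t <= 1 -> t - s < r ->
    Y t w = Y s w /\ XB t w - XS t w = XB s w - XS s w.
Proof.
move=> s0.
have [r1 r10 h1] := steps_right_const hZB s0.
have [r2 r20 h2] := steps_right_const hZS s0.
have [r3 r30 h3] := steps_right_const hB s0.
have [r4 r40 h4] := steps_right_const hS s0.
exists (Num.min (Num.min r1 r2) (Num.min r3 r4)).
  by rewrite !lt_min r10 r20 r30 r40.
move=> t st t1; rewrite !lt_min => /andP[/andP[a b] /andP[e f]].
by rewrite /Y /total_demand /noise h1// h2// h3// h4.
Qed.

(** Y is constant for a while after each jump, so only the Lipschitz dependence of the price on time
    remains. *)
Lemma profit_cvg K : 0 <= K ->
  (forall y s t, grid delta y -> 0 <= s -> s <= t -> t <= 1 ->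
    `|p y s - p y t| <= K * (t - s)) ->
  (forall t, 0 <= t <= 1 -> grid delta (Y t w)) ->
  riemann (fun t => v w - p (Y t w) t) (fun t => XB t w - XS t w) n @[n --> \oo] -->
  profit delta v ZB ZS p XB XS w.
Proof.
move=> K0 pK gY; rewrite profit_steps.
have rc s : 0 < s <= 1 -> right_cont01 (fun t => v w - p (Y t w) t) s.
  move=> /andP[s0 s1] e e0; have [r r0 rP] := demand_right_const (ltW s0).
  exists (Num.min r (e / (K + 1))).
    by rewrite lt_min r0 divr_gt0// ltr_wpDl.
  move=> t st t1; rewrite lt_min => /andP[tr te].
  have [-> _] := rP _ st t1 tr.
  have -> : v w - p (Y s w) t - (v w - p (Y s w) s) = p (Y s w) s - p (Y s w) t by ring.
  apply: (le_lt_trans (pK _ _ _ _ (ltW s0) st t1)).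
    by apply: gY; rewrite (ltW s0).
  move: te; rewrite ltr_pdivlMr ?ltr_wpDl//; apply: le_lt_trans.
  by rewrite mulrC ler_wpM2l ?subr_ge0// lerDl.
rewrite [X in X @ _](_ : _ = fun n =>
    riemann (fun t => v w - p (Y t w) t) (XB ^~ w) n -
    riemann (fun t => v w - p (Y t w) t) (XS ^~ w) n).
  apply: cvgB; apply: riemann_cvg => // s sJ; apply: rc.
    exact: (steps_itv hB).
  exact: (steps_itv hS).
by apply/funext => n; rewrite riemannB.
Qed.

End PathwiseProfit.

(** * A convex potential for the insider's gains *)

Section TerminalPotential.
Context {R : realType}.
Variables (delta z : R).
Hypotheses (delta0 : 0 < delta) (gz : grid delta z).
Implicit Types (a b zeta : R) (x : R -> R).

(* The profit of an insider with value a who could trade at time 1 knowing that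
   the noise orders alone would have led to b. *)
Definition potential a b : R :=
  if a == 1 then Num.max (z - delta - b) 0 else Num.max (b - z) 0.

(** The bridge price at time 1, when demand ends at [b]. *)
Definition sells_at b : R := (z <= b)%R%:R.

Lemma potential_ge0 a b : 0 <= potential a b.
Proof. by rewrite /potential; case: ifP; rewrite le_max lexx orbT. Qed.

Lemma grid_gap b : grid delta b -> b < z -> b <= z - delta.
Proof.
move=> [j ->]; have [k ->] := gz; rewrite ltr_pM2r// ltr_int => jk.
by rewrite -[X in _ - X]mul1r -mulrBl ler_pM2r// -(rmorphB _ k 1)/= ler_int; lia.
Qed.

(** [sells_at b' - a] is a subgradient at [b'] of the convex function [potential a]. For a = 1 the
    grid matters: it has no point strictly between the kink z - delta and z, where [sells_at]
    jumps. *)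
Lemma potential_step a b b' : a = 0 \/ a = 1 -> grid delta b' ->
  (a - sells_at b') * (b' - b) <= potential a b - potential a b'.
Proof.
move=> [->|->] gb'; rewrite /potential ?eqxx ?[0 == 1]eq_sym ?oner_eq0 /sells_at;
  have := delta0; case: (leP z b') => [zb|/(grid_gap gb') zb] /=;
  by rewrite !maxEle; do 2!case: ifP; move=> *; lra.
Qed.

(** A single grid step never crosses a kink, so the potential is affine along it and the subgradient
    inequality is tight. The two kinks differ by [delta] because a buy that brings demand to z is
    marked at 1 and earns nothing when a = 1. *)
Lemma potential_step_eq a b : a = 0 \/ a = 1 -> grid delta b ->
  let b' := if a == 1 then b + delta else b - delta in
  (a - sells_at b') * (b' - b) = potential a b - potential a b'.
Proof.
have gD : grid delta delta by exists 1; rewrite mul1r.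
move=> [->|->] gb; rewrite /potential ?eqxx ?[0 == 1]eq_sym ?oner_eq0 /sells_at /=;
  have := delta0.
  case: (leP z (b - delta)) => [zb|/(grid_gap (gridB gb gD)) zb] /=;
  by rewrite !maxEle; do 2!case: ifP; move=> *; lra.
case: (leP z (b + delta)) => [zb|/(grid_gap (gridD gb gD)) zb] /=;
by rewrite !maxEle; do 2!case: ifP; move=> *; lra.
Qed.

Lemma potential_sum a zeta n : a = 0 \/ a = 1 -> grid delta zeta ->
  let sg := if a == 1 then 1 else -1 in
  \sum_(k <- iota 0 n) (a - sells_at (zeta + sg * (delta *+ k.+1))) * (sg * delta) =
  potential a zeta - potential a (zeta + sg * (delta *+ n)).
Proof.
move=> a01 gzeta sg.
pose b k := zeta + sg * (delta *+ k).
have gb k : grid delta (b k).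
  rewrite /b /sg; have gk : grid delta (delta *+ k).
    by exists k; rewrite -pmulrn mulr_natl.
  by case: ifP => _; rewrite ?mul1r ?mulN1r; [exact: gridD|exact: gridB].
have bS k : b k.+1 = if a == 1 then b k + delta else b k - delta.
  by rewrite /b /sg mulrSr; case: ifP => _; ring.
elim: n => [|n IH]; first by rewrite big_nil mulr0n mulr0 addr0 subrr.
rewrite -addn1 iotaD big_cat IH /= big_seq1 add0n addn1 -!/(b _).
have -> : sg * delta = b n.+1 - b n by rewrite /b mulrSr; ring.
by have := potential_step_eq a01 (gb n); rewrite /= -bS => ->; ring.
Qed.

End TerminalPotential.
(** * Optimality *)

Section InsiderInformation.
Context {R : realType} {d : measure_display} {T : measurableType d}.
Variables (P : probability T R) (FF : R -> set (set T)) (delta beta : R).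
Variables (v : T -> R) (ZB ZS : R -> T -> R).
Hypotheses (delta0 : 0 < delta) (beta0 : 0 < beta).
Hypothesis mkt : market P delta beta v ZB ZS FF.

Local Notation pr A := (fine (P A)).
Let N : R -> T -> R := fun t w => ZB t w / delta.
Let M : R -> T -> R := fun t w => ZS t w / delta.
Let pN : poisson_process P beta N := market_poisson_buy mkt.
Let pM : poisson_process P beta M := market_poisson_sell mkt.
Let NM : indep P (natural_filtration N 1) (natural_filtration M 1) := market_indep mkt.

Lemma value_sigma_measurable : sigma_rv v `<=` measurable.
Proof. exact/sigma_rv_measurable/(market_value_measurable mkt). Qed.

Lemma noise_incr_natural t : 0 <= t -> t <= 1 ->
  sigma_rv (fun w => noise ZB ZS 1 w - noise ZB ZS t w) `<=`
  natural_filtration (noise ZB ZS) 1.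
Proof.
move=> t0 t1; apply: sigma_rv_subB; first exact: smallest_sigma_algebra.
  by apply: natural_adapted => //; exact: ler01.
exact: natural_adapted.
Qed.

(** [FI t] is generated by triple intersections of events of [v], of the past noise and of [HH t].
    The last splits off first, [v] next, and what remains is the independence of past and increment
    of the noise. *)
Lemma information_indep XB XS FI t : admissible P delta v ZB ZS XB XS FI ->
  0 <= t -> t <= 1 ->
  indep P (FI t) (sigma_rv (fun w => noise ZB ZS 1 w - noise ZB ZS t w)).
Proof.
move=> adm t0 t1; have t01 : 0 <= t <= 1 by rewrite t0.
have [HH [fH iH ->]] := admissible_information adm; last exact: t01.
set eta := fun w => _.
have sH := filtration_sigma_algebra fH t01; have mH := filtration_measurable fH t01.
have sv := sigma_rv_sigma_algebra v; have mv := value_sigma_measurable.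
have mpast s : s <= 1 -> past N M s `<=` measurable := past_measurable pN pM (t := s).
have nat_past s : natural_filtration (noise ZB ZS) s `<=` past N M s.
  exact: (noise_natural_past delta0).
have mnat s : s <= 1 -> natural_filtration (noise ZB ZS) s `<=` measurable.
  by move=> s1 A /nat_past; exact: mpast.
have sn s : sigma_algebra setT (natural_filtration (noise ZB ZS) s).
  exact: smallest_sigma_algebra.
have eta_nat := noise_incr_natural t0 t1; rewrite -/eta in eta_nat.
have seta : sigma_rv eta `<=` sigma_rv (skellam N M t 1).
  rewrite (_ : eta = fun w => delta * skellam N M t 1 w); first exact: sigma_rv_scale.
  by apply/funext => w; exact: (noise_incr ZB ZS delta0).
have sub : <<s sigma_rv v `|` natural_filtration (noise ZB ZS) t `|` HH t >> `<=`
    <<s meets (meets (sigma_rv v) (natural_filtration (noise ZB ZS) t)) (HH t) >>.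
  apply: sub_sigma_algebra2; apply: subset_trans (setU_meets _ _).
  - by apply: setSU; apply: setU_meets; exact: sigma_setT.
  - by exists setT, setT; rewrite setIT; split=> //; exact: sigma_setT.
  - exact: sigma_setT.
apply: (indepS sub (fun _ => id)).
apply: indep_generatedl.
- do 2?[apply: meets_setI_closed]; exact: sigma_setI_closed.
- by do 2?[apply: meets_measurable] => //; exact: mnat.
- by move=> A /eta_nat; exact: mnat.
move=> _ D [_ [C [[A [B [vA nB ->]]] HC ->]]] hD.
have vZ A' B' : sigma_rv v A' -> natural_filtration (noise ZB ZS) 1 B' ->
    <<s sigma_rv v `|` natural_filtration (noise ZB ZS) 1 >> (A' `&` B').
  move=> hA hB; apply: (sigma_setI (smallest_sigma_algebra _ _)).
    by apply: sub_sigma_algebra; left.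
  by apply: sub_sigma_algebra; right.
have past_pair : past N M 1 `<=`
    <<s natural_filtration ZB 1 `|` natural_filtration ZS 1 >>.
  by apply: sub_sigma_algebra2; apply: setUSS; exact: natural_scale.
have vP A' B' : sigma_rv v A' -> natural_filtration (noise ZB ZS) 1 B' ->
    P (A' `&` B') = (P A' * P B')%E.
  by move=> hA /nat_past/past_pair hB; exact: (market_value_indep mkt).
have nB1 : natural_filtration (noise ZB ZS) 1 B := natural_le t1 nB.
have nBD : natural_filtration (noise ZB ZS) 1 (B `&` D).
  by apply: (sigma_setI (sn 1)) => //; exact: eta_nat.
rewrite (setIC _ C) -setIA -setIA.
rewrite (iH t t01 _ _ HC (vZ _ _ vA nBD)) (iH t t01 _ _ HC (vZ _ _ vA nB1)).
rewrite (vP _ _ vA nBD) (vP _ _ vA nB1).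
rewrite (past_indep pN pM NM t0 t1 (lexx 1) (nat_past _ _ nB) (seta _ hD)).
by rewrite !muleA.
Qed.

Lemma poisson_steps (Z : R -> T -> R) w :
  poisson_process P beta (fun t w => Z t w / delta) ->
  exists J, uniq J /\ steps delta J (Z ^~ w).
Proof.
move=> pZ; have [J [uJ hJ _ _]] := point_path_steps ltr01 (poisson_path pZ w).
exists J; split => //; have := steps_scale delta hJ; rewrite mulr1.
by under eq_fun do rewrite mulrC divfK ?gt_eqF//.
Qed.

(** Both processes move in a given cell of width 1/(n+1) with probability at most (beta/(n+1))^2,
    hence in some common cell with probability at most beta^2/(n+1). A common jump forces this for
    every n. *)
Lemma no_common_noise_jump : {ae P, forall w, forall JZB JZS,
  steps delta JZB (ZB ^~ w) -> steps delta JZS (ZS ^~ w) ->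
  forall s, s \in JZB -> s \notin JZS}.
Proof.
pose E n i := ~` (incr N (mesh n i) (mesh n i.+1) @^-1` [set 0]) `&`
              ~` (incr M (mesh n i) (mesh n i.+1) @^-1` [set 0]).
have m_itv n i : (i < n.+1)%N ->
    [/\ (0 : R) <= mesh n i, mesh n i <= mesh n i.+1 :> R & mesh n i.+1 <= 1 :> R].
  move=> i_n; split; last 1 first.
  - by have /andP[] := mesh_itv (R := R) i_n.
  - by have /andP[] := mesh_itv (R := R) (ltnW i_n).
  - exact: le_mesh.
have mE n i : (i < n.+1)%N -> measurable (E n i).
  move=> /m_itv[a b c]; apply: measurableI; apply: measurableC.
    exact: (incr_measurable pN).
  exact: (incr_measurable pM).
have pEn n i : (i < n.+1)%N -> pr (E n i) <= (beta / n.+1%:R) ^+ 2.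
  move=> /m_itv[a b c].
  rewrite (pr_indep (natural_measurable pN (lexx 1)) (natural_measurable pM (lexx 1)) NM).
  - have := pr_incr_neq0 beta0 pN a b c; have := pr_incr_neq0 beta0 pM a b c.
    rewrite meshS [_ + _ - _]addrC addKr expr2 => hM hN.
    by apply: ler_pM => //; exact: pr_ge0.
  - apply: sigma_algebraC; apply: (incr_natural a b c).
    exact: sigma_rv_preimage.
  - apply: sigma_algebraC; apply: (incr_natural a b c).
    exact: sigma_rv_preimage.
pose A n := \big[setU/set0]_(i < n.+1) E n i.
have mA n : measurable (A n) by apply: bigsetU_measurable => i _; exact: mE.
have prA n : pr (A n) <= beta ^+ 2 * n.+1%:R^-1.
  rewrite -lee_fin -(prE P (mA n)).
  have boole : (P (A n) <= \sum_(i < n.+1) P (E n i))%E.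
    exact: (Boole_inequality P (n := n.+1) (mE n)).
  apply: (le_trans boole).
  apply: (@le_trans _ _ (\sum_(i < n.+1) ((beta / n.+1%:R) ^+ 2)%:E)%E).
    by apply: lee_sum => i _; rewrite (prE P (mE _ _ (ltn_ord i))) lee_fin pEn.
  rewrite sumEFin lee_fin sumr_const card_ord -[leLHS]mulr_natr.
  have : n.+1%:R != 0 :> R by rewrite pnatr_eq0.
  by move: n.+1%:R => c c0; rewrite le_eqVlt; apply/orP; left; apply/eqP; field.
exists (\bigcap_n A n); split.
- exact: bigcapT_measurable.
- have mcap : measurable (\bigcap_n A n) by exact: bigcapT_measurable.
  rewrite (prE P mcap); congr EFin; apply/eqP; rewrite eq_le pr_ge0 andbT.
  apply/ler_addgt0Pl => e e0; rewrite addr0.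
  have e'0 : 0 < e / beta ^+ 2 by rewrite divr_gt0// exprn_gt0.
  near \oo => n.
  apply: (@le_trans _ _ (pr (A n))).
    by apply: pr_le => // w; apply.
  apply: (le_trans (prA n)); rewrite mulrC -ler_pdivlMr ?exprn_gt0// ltW//.
  by near: n; exact: near_infty_natSinv_lt (PosNum e'0).
- move=> w /existsNP[JZB /existsNP[JZS]].
  move=> /not_implyP[hZB /not_implyP[hZS /existsNP[s]]].
  move=> /not_implyP[sB /negP]; rewrite negbK => sS n _.
  have s01 := steps_itv hZB sB.
  have [i /[dup] si /andP[_ _] _] := mesh_cell n s01.
  have [a b c] := m_itv n i (ltn_ord i).
  have neq Z J : steps delta J (Z ^~ w) -> s \in J ->
      ~ incr (fun t w => Z t w / delta) (mesh n i) (mesh n i.+1) w = 0.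
    move=> hJ sJ; have := steps_lt delta0 hJ sJ a si c; rewrite /incr => lt0 /eqP.
    by rewrite -mulrBl mulf_eq0 invr_eq0 (gt_eqF delta0) orbF subr_eq0 gt_eqF.
  rewrite /A (bigD1 i)//=; left; split; [exact: (neq _ JZB)|exact: (neq _ JZS)].
Unshelve. all: by end_near. Qed.

End InsiderInformation.
Section Strategy.
Context {R : realType} {d : measure_display} {T : measurableType d}.
Variables (P : probability T R) (FF : R -> set (set T)) (delta beta : R).
Variables (v : T -> R) (ZB ZS : R -> T -> R).
Hypotheses (delta0 : 0 < delta) (beta0 : 0 < beta).
Hypothesis mkt : market P delta beta v ZB ZS FF.
Variables (p : R -> R -> R) (z : R).
Hypotheses (gz : grid delta z) (pp : pricing_rule delta p).
Hypothesis pE : forall y t, grid delta y -> 0 <= t <= 1 ->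
  p y t = bridge_price P ZB ZS z y t.

Local Notation pr A := (fine (P A)).
Local Notation Zt := (noise ZB ZS).

(** On the exceptional null set [f] is arbitrary; measurability there comes from completeness. *)
Lemma ae_limit_measurable (h : nat -> T -> R) (f : T -> R) :
  (forall n, measurable_fun setT (h n)) ->
  {ae P, forall w, h n w @[n --> \oo] --> f w} -> measurable_fun setT f.
Proof.
move=> mh [C [mC PC hC]] _ B mB; rewrite setTI.
rewrite -(setIT (f @^-1` B)) -(setvU C) setIUr; apply: measurableU.
  rewrite setIC; have mCf : measurable_fun (~` C) f.
    apply: (@measurable_fun_cvg _ _ _ _ h) => [n|w /= nw].
      exact: measurable_funTS.
    by apply: contrapT => hw; apply: nw; exact: hC.
  by apply: mCf => //; exact: measurableC.
apply: (market_negligible_measurable mkt).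
by exists C; split => //; exact: subIsetr.
Qed.

Lemma price_lipschitz y s t : grid delta y -> 0 <= s -> s <= t -> t <= 1 ->
  `|p y s - p y t| <= 2 * beta * (t - s).
Proof.
move=> gy s0 st t1; rewrite !pE ?s0 ?t1 ?(le_trans s0 st) ?(le_trans st t1)//.
rewrite !(bridge_priceE delta0 mkt) ?s0 ?t1 ?(le_trans s0 st) ?(le_trans st t1)//.
rewrite -mulrA; exact: (skellam_tail_lipschitz beta0 (market_poisson_buy mkt)
  (market_poisson_sell mkt)).
Qed.

Variables (XB XS : R -> T -> R) (FI : R -> set (set T)).
Hypothesis adm : admissible P delta v ZB ZS XB XS FI.

Let Y := total_demand ZB ZS XB XS.
Let X t w := XB t w - XS t w.
Let fFI := usual_is_filtration (admissible_usual adm).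
Let pB w : point_path delta (XB ^~ w) := (admissible_path adm w).1.
Let pS w : point_path delta (XS ^~ w) := (admissible_path adm w).2.

(** Whether demand would end at or above z if the insider stopped trading at [t]. *)
Definition marked t w := sells_at z (Zt 1 w + X t w).

Lemma demand_information t : 0 <= t <= 1 -> sigma_rv (Y t) `<=` FI t.
Proof.
move=> t01; have sF := filtration_sigma_algebra fFI t01.
have [aB aS] := admissible_adapted adm.
apply: sigma_rv_subD => //; last by apply: sigma_rv_subB => //; [exact: aB|exact: aS].
have [HH [_ _ FIE]] := admissible_information adm; rewrite FIE//.
move=> A hA; apply: sub_sigma_algebra; left; right.
by case/andP: t01 => t0 t1; exact: (natural_adapted (N := Zt) t0 (lexx t)).
Qed.

Lemma information_measurable t : 0 <= t <= 1 -> FI t `<=` measurable.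
Proof. exact: filtration_measurable. Qed.

Lemma value_information t A : 0 <= t <= 1 -> sigma_rv v A -> FI t A.
Proof.
move=> t01 vA; have [HH [_ _ FIE]] := admissible_information adm.
by rewrite FIE//; apply: sub_sigma_algebra; left; left.
Qed.

Lemma noise_measurable t : 0 <= t <= 1 -> measurable_fun setT (Zt t).
Proof.
move=> t01; apply/sigma_rv_measurable => A hA.
have /andP[t0 t1] := t01.
apply: (past_measurable (market_poisson_buy mkt) (market_poisson_sell mkt) t1).
apply: (noise_natural_past delta0).
exact: (natural_adapted (N := Zt) t0 (lexx t)).
Qed.

Lemma adapted_measurable (V : R -> T -> R) t : adapted FI V -> 0 <= t <= 1 ->
  measurable_fun setT (V t).
Proof.
by move=> aV t01; apply/sigma_rv_measurable => A /(aV _ t01); exact: information_measurable.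
Qed.

Lemma X_measurable t : 0 <= t <= 1 -> measurable_fun setT (X t).
Proof.
have [aB aS] := admissible_adapted adm.
move=> t01; apply: measurable_funB.
  exact: (adapted_measurable aB).
exact: (adapted_measurable aS).
Qed.

Lemma marked_indic t w : marked t w = \1_[set w | z <= Zt 1 w + X t w] w.
Proof.
rewrite /marked /sells_at indicE; congr (nat_of_bool _)%:R.
by apply/idP/idP => [h|/set_mem//]; apply/mem_set.
Qed.

Lemma marked_measurable t : 0 <= t <= 1 -> measurable_fun setT (marked t).
Proof.
move=> t01; rewrite (_ : marked t = \1_[set w | z <= Zt 1 w + X t w]); last first.
  by apply/funext => w; exact: marked_indic.
apply: measurable_indic.
rewrite [S in measurable S](_ : _ = (fun w => Zt 1 w + X t w) @^-1` `[z, +oo[).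
  rewrite -[S in measurable S]setTI; apply: measurable_funD => //.
    by apply: noise_measurable; rewrite ler01 lexx.
  exact: X_measurable.
by apply/seteqP; split=> w /=; rewrite in_itv/= andbT.
Qed.

Lemma path_bound (x : R -> R) t : point_path delta x -> 0 <= t <= 1 ->
  0 <= x t <= x 1.
Proof.
move=> xP /andP[t0 t1]; rewrite -{1}(point_path0 xP).
by rewrite !(point_path_nondecreasing xP).
Qed.

Lemma path_integrable (V : R -> T -> R) t : adapted FI V ->
  (forall w, point_path delta (V ^~ w)) -> ('E_P[V 1%R] < +oo)%E -> 0 <= t <= 1 ->
  P.-integrable setT (EFin \o V t).
Proof.
move=> aV pV eV t01; have t11 : 0 <= (1 : R) <= 1 by rewrite ler01/=.
have i1 : P.-integrable setT (EFin \o V 1).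
  apply/integrableP; split; first exact/measurable_EFinP/(adapted_measurable aV).
  apply: le_lt_trans eV; rewrite expectation.unlock.
  under eq_integral do rewrite /= ger0_norm ?(andP (path_bound (pV _) t11)).1//.
  by [].
apply: (le_integrable _ _ _ i1) => //.
  exact/measurable_EFinP/(adapted_measurable aV).
move=> w _ /=; have /andP[a b] := path_bound (pV w) t01.
by rewrite lee_fin !ger0_norm//; exact: le_trans b.
Qed.

(* The price is the conditional law of the future noise, so against increments
   of an adapted process it can be replaced by the event it is the probability
   of: final noise plus current insider position reaches z. *)
Lemma riemann_freeze (V : R -> T -> R) A n : adapted FI V ->
  (forall w, point_path delta (V ^~ w)) -> ('E_P[V 1%R] < +oo)%E -> sigma_rv v A ->
  let K := fun w => riemann (fun t => marked t w - p (Y t w) t) (V ^~ w) n in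
  P.-integrable A (EFin \o K) /\ (\int[P]_(w in A) (K w)%:E = 0)%E.
Proof.
move=> aV pV eV vA K; have mA := value_sigma_measurable mkt vA.
(* Since Y_t + (Z_1 - Z_t) = Z_1 + X_t, freezing at the right endpoint relates the price to
   [marked]; the increment of [V] is known there. *)
pose H (i : 'I_n.+1) w := (V (mesh n i.+1) w - V (mesh n i) w) *
  (\1_[set w | z <= Y (mesh n i.+1) w + (Zt 1 w - Zt (mesh n i.+1) w)] w -
   pr [set w' | z <= Y (mesh n i.+1) w + (Zt 1 w' - Zt (mesh n i.+1) w')]).
have KE w : K w = \sum_(i < n.+1) H i w.
  apply: eq_bigr => i _; rewrite /H mulrC; congr (_ * (_ - _)).
    rewrite marked_indic; congr (\1_ _ w); apply/seteqP; rewrite /X.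
    by split=> u /=; rewrite /Y /total_demand; lra.
  have t01 := mesh_itv (R := R) (ltn_ord i).
  rewrite pE//; last exact: (demand_grid delta0 mkt w adm t01).
  by rewrite (bridge_priceE delta0 mkt)// (tail_event ZB ZS delta0).
have iH i : P.-integrable A (EFin \o H i) /\ (\int[P]_(w in A) (H i w)%:E = 0)%E.
  have t01 := mesh_itv (R := R) (ltn_ord i).
  have s01 := mesh_itv (R := R) (ltnW (ltn_ord i)).
  have /andP[t0 t1] := t01; have /andP[s0 s1] := s01.
  apply: (@integral_freeze _ _ _ P delta delta z (FI (mesh n i.+1))
    (fun w => V (mesh n i.+1) w - V (mesh n i) w) (Y (mesh n i.+1))
    (fun w => Zt 1 w - Zt (mesh n i.+1) w)) => //.
  - exact: filtration_sigma_algebra t01.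
  - exact: information_measurable.
  - apply: sigma_rv_subB; first exact: filtration_sigma_algebra t01.
      exact: aV.
    apply: (subset_trans (aV _ s01)).
    by apply: (filtration_mono fFI) => //; exact: le_mesh.
  - exact: demand_information.
  - exact: value_information.
  - apply: measurable_funB; apply: noise_measurable => //.
    by rewrite ler01 lexx.
  - exact: (information_indep delta0 mkt adm).
  - by move=> w; apply: gridB; apply: (point_path_grid (pV w)).
  - by move=> w; exact: (demand_grid delta0 mkt w adm t01).
  - exact: (integrableB measurableT (path_integrable aV pV eV t01)
      (path_integrable aV pV eV s01)).
rewrite (_ : K = fun w => \sum_(i < n.+1) H i w); last exact/funext.
split.
  under [F in _.-integrable _ F]eq_fun do rewrite /= -sumEFin.
  by apply: integrable_sum => // i _; have [] := iH i.
under eq_integral do rewrite -sumEFin.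
rewrite (integral_sum mA (f := fun i w => (H i w)%:E)); last by move=> i; have [] := iH i.
by apply: big1 => i _; have [] := iH i.
Qed.

Definition discrete_profit n w := riemann (fun t => v w - p (Y t w) t) (X ^~ w) n.

Definition marked_profit n w := riemann (fun t => v w - marked t w) (X ^~ w) n.

Let volume w := XB 1 w + XS 1 w.

(** The bound is uniform in n: the traded volume, integrable by admissibility, is the dominating
    function in every limit below. *)
Lemma demand_riemann_bound (f : R -> R) n w : (forall t, 0 <= t <= 1 -> `|f t| <= 1) ->
  `|riemann f (X ^~ w) n| <= volume w.
Proof.
move=> f1; rewrite /X riemannB; apply: (le_trans (ler_normB _ _)).
have b (V : R -> T -> R) : point_path delta (V ^~ w) ->
    `|riemann f (V ^~ w) n| <= V 1 w.
  move=> pV; have := riemann_bound n f1 (point_path_nondecreasing pV).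
  by rewrite (point_path0 pV) subr0 mul1r.
by apply: lerD; apply: b.
Qed.

Lemma discrete_profit_bound n w : `|discrete_profit n w| <= volume w.
Proof.
apply: demand_riemann_bound => t t01.
have /andP[p0 p1] := pricing_range pp (demand_grid delta0 mkt w adm t01) t01.
move: p0 p1; rewrite -/Y; move: (p _ _) => q q0 q1.
by case: (market_value mkt w) => ->; rewrite ler_norml; apply/andP; split; lra.
Qed.

Lemma marked_profit_bound n w : `|marked_profit n w| <= volume w.
Proof.
apply: demand_riemann_bound => t t01; rewrite /marked /sells_at.
by case: (market_value mkt w) => ->; case: (z <= _) => /=;
  rewrite ler_norml; apply/andP; split; lra.
Qed.

Lemma marked_profit_measurable n : measurable_fun setT (marked_profit n).
Proof.
apply: measurable_sum => i; have t01 := mesh_itv (R := R) (ltn_ord i).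
have s01 := mesh_itv (R := R) (ltnW (ltn_ord i)).
apply: measurable_funM.
  apply: measurable_funB; first exact: market_value_measurable mkt.
  exact: marked_measurable.
by apply: measurable_funB; exact: X_measurable.
Qed.

Lemma volume_integrable : P.-integrable setT (EFin \o volume).
Proof.
have [aB aS] := admissible_adapted adm; have [eB eS] := admissible_integrable adm.
have t11 : 0 <= (1 : R) <= 1 by rewrite ler01/=.
exact: (integrableD measurableT (path_integrable aB pB eB t11)
  (path_integrable aS pS eS t11)).
Qed.

(** The replacement error is split between [XB] and [XS] because [riemann_freeze] concerns a single
    point path. *)
Lemma discrete_marked n w : discrete_profit n w = marked_profit n w +
  (riemann (fun t => marked t w - p (Y t w) t) (XB ^~ w) n -
   riemann (fun t => marked t w - p (Y t w) t) (XS ^~ w) n).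
Proof.
rewrite -riemannB /discrete_profit /marked_profit.
rewrite /riemann -big_split/=; apply: eq_bigr => i _; rewrite /X; ring.
Qed.

Lemma marked_profit_integrable n A : measurable A ->
  P.-integrable A (EFin \o marked_profit n).
Proof.
move=> mA; apply: (integrableS measurableT) => //.
apply: (le_integrable _ _ _ volume_integrable) => //.
  exact/measurable_EFinP/marked_profit_measurable.
move=> w _ /=; rewrite lee_fin (le_trans (marked_profit_bound _ _))//.
exact: ler_norm.
Qed.

Lemma value_setT : sigma_rv v setT.
Proof. exact: sigma_setT (sigma_rv_sigma_algebra v). Qed.

Lemma discrete_profit_integral n A : sigma_rv v A ->
  measurable_fun setT (discrete_profit n) /\
  (\int[P]_(w in A) (discrete_profit n w)%:E =
   \int[P]_(w in A) (marked_profit n w)%:E)%E.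
Proof.
move=> vA; have mA := value_sigma_measurable mkt vA.
have [aB aS] := admissible_adapted adm; have [eB eS] := admissible_integrable adm.
have [iB B0] := riemann_freeze n aB pB eB vA.
have [iS S0] := riemann_freeze n aS pS eS vA.
have [iBT _] := riemann_freeze n aB pB eB value_setT.
have [iST _] := riemann_freeze n aS pS eS value_setT.
rewrite /= in iB B0 iS S0 iBT iST; split.
  rewrite (_ : discrete_profit n = fun w => marked_profit n w +
    (riemann (fun t => marked t w - p (Y t w) t) (XB ^~ w) n -
     riemann (fun t => marked t w - p (Y t w) t) (XS ^~ w) n)); last first.
    by apply/funext => w; exact: discrete_marked.
  apply: measurable_funD; first exact: marked_profit_measurable.
  apply: measurable_funB; apply/measurable_EFinP.
    exact: measurable_int iBT.
  exact: measurable_int iST.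
under eq_integral do rewrite discrete_marked EFinD EFinB.
rewrite integralD//; [|exact: marked_profit_integrable|exact: integrableB].
by rewrite integralB// B0 S0 subee// adde0.
Qed.

Lemma profit_limit : {ae P, forall w,
  discrete_profit n w @[n --> \oo] --> profit delta v ZB ZS p XB XS w}.
Proof.
apply: filterS2 (no_common_noise_jump delta0 beta0 mkt) (admissible_no_simultaneous adm).
move=> w noZ noX.
have [JZB [uZB hZB]] := poisson_steps delta0 w (market_poisson_buy mkt).
have [JZS [uZS hZS]] := poisson_steps delta0 w (market_poisson_sell mkt).
have [JB [uB hB _ _]] := point_path_steps delta0 (pB w).
have [JS [uS hS _ _]] := point_path_steps delta0 (pS w).
apply: (profit_cvg delta0 uZB uZS uB uS hZB hZS hB hS (noZ _ _ hZB hZS) _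
  (K := 2 * beta)).
- move=> s sB; have s01 := steps_itv hB sB; apply/negP => sS.
  have := noX s s01; rewrite (steps_jump uB hB s01) (steps_jump uS hS s01) sB sS.
  by case=> /eqP; rewrite gt_eqF.
- by rewrite mulr_ge0// ltW.
- exact: price_lipschitz.
- by move=> t t01; exact: (demand_grid delta0 mkt w adm t01).
Qed.

(** Discrete profits converge almost surely under the volume, and for every n their integrals over
    events of sigma(v) are those of the marked profits. *)
Lemma profit_integral A : sigma_rv v A ->
  P.-integrable A (EFin \o profit delta v ZB ZS p XB XS) /\
  (\int[P]_(w in A) (marked_profit n w)%:E @[n --> \oo] -->
   \int[P]_(w in A) (profit delta v ZB ZS p XB XS w)%:E)%E.
Proof.
move=> vA; have mA := value_sigma_measurable mkt vA.
have mf n := (discrete_profit_integral n vA).1.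
have mprofit := ae_limit_measurable mf profit_limit.
have [|||||iprofit _ lim] := @dominated_convergence _ _ _ P A mA
  (fun n w => (discrete_profit n w)%:E) (EFin \o profit delta v ZB ZS p XB XS)
  (EFin \o volume).
- by move=> n; exact/measurable_EFinP/measurable_funTS.
- exact/measurable_EFinP/measurable_funTS.
- by apply: filterS profit_limit => w hw _; apply: cvg_EFin => //; exact: nearW.
- exact: integrableS volume_integrable.
- by apply: aeW => w n _ /=; rewrite lee_fin; exact: discrete_profit_bound.
split => //.
by under eq_cvg do rewrite -(discrete_profit_integral _ vA).2.
Qed.

(** The subgradient inequality telescopes along the grid, and the potential left at the end is
    nonnegative. *)
Lemma marked_profit_le n w : marked_profit n w <= potential delta z (v w) (Zt 1 w).
Proof.
have g01 : grid delta (Zt 1 w).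
  by apply: (noise_grid delta0 mkt); rewrite ler01 lexx.
have X0 : X 0 w = 0 by rewrite /X (point_path0 (pB w)) (point_path0 (pS w)) subrr.
have : marked_profit n w <= potential delta z (v w) (Zt 1 w + X 0 w) -
                            potential delta z (v w) (Zt 1 w + X 1 w).
  apply: (riemann_telescope (psi := fun x => potential delta z (v w) (Zt 1 w + x))).
  move=> s t s0 st t1; rewrite (_ : X t w - X s w = Zt 1 w + X t w - (Zt 1 w + X s w)).
    apply: (potential_step delta0 gz); first exact: market_value mkt w.
    have t01 : 0 <= t <= 1 by rewrite t1 (le_trans s0).
    apply: gridD => //; apply: gridB.
      exact: (point_path_grid (pB w)).
    exact: (point_path_grid (pS w)).
  by ring.
rewrite X0 addr0 => /le_trans; apply.
by rewrite gerBl; exact: potential_ge0.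
Qed.

End Strategy.
Section OptimalStrategy.
Context {R : realType}.
Variables (delta z : R).
Hypotheses (delta0 : 0 < delta) (gz : grid delta z).

(** Each single step in the direction favoured by [a] gives equality in the potential. The grid sums
    attain this only in the limit, as several jumps may share a cell. *)
Lemma riemann_potential (x y : R -> R) a zeta : point_path delta y ->
  a = 0 \/ a = 1 -> grid delta zeta ->
  (forall t, 0 <= t <= 1 -> x t = (if a == 1 then 1 else -1) * y t) ->
  riemann (fun t => a - sells_at z (zeta + x t)) x n @[n --> \oo] -->
  potential delta z a zeta - potential delta z a (zeta + x 1).
Proof.
move=> py a01 gzeta; set sg := (if _ then _ else _) => xy.
have [J [uJ hJ y1 yJ]] := point_path_steps delta0 py.
have t11 : 0 <= (1 : R) <= 1 by rewrite ler01/=.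
rewrite [X in X @ _](_ : _ = fun n =>
    sg * riemann (fun t => a - sells_at z (zeta + sg * y t)) y n); last first.
  apply/funext => n; rewrite /riemann mulr_sumr; apply: eq_bigr => i _.
  have i1 := mesh_itv (R := R) (ltn_ord i).
  have i0 := mesh_itv (R := R) (ltnW (ltn_ord i)).
  by rewrite !xy//; ring.
(* At its jump times [y] runs through delta, 2 delta, and so on, which yields the sum in
   [potential_sum]. *)
have <- : sg * \sum_(s <- J) (a - sells_at z (zeta + sg * y s)) * delta =
    potential delta z a zeta - potential delta z a (zeta + x 1).
  rewrite xy// y1 -(potential_sum delta0 gz (size J) a01 gzeta) -/sg.
  rewrite -(big_map y xpredT (fun b => (a - sells_at z (zeta + sg * b)) * delta)) yJ.
  by rewrite big_map mulr_sumr; apply: eq_bigr => k _; ring.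
apply: cvgMr; apply: riemann_cvg => // s sJ e e0.
have /andP[/ltW s0 _] := steps_itv hJ sJ.
have [r r0 rP] := steps_right_const hJ s0; exists r => // t st t1 tr.
by rewrite (rP _ st t1 tr) subrr normr0.
Qed.

End OptimalStrategy.

(** * Optimality of the inconspicuous strategy *)

Section Equilibrium.
Context {R : realType} {d : measure_display} {T : measurableType d}.
Variables (P : probability T R) (FF : R -> set (set T)) (delta beta : R).
Variables (v : T -> R) (ZB ZS : R -> T -> R).
Hypotheses (delta0 : 0 < delta) (beta0 : 0 < beta).
Hypothesis mkt : market P delta beta v ZB ZS FF.

Local Notation pr A := (fine (P A)).
Local Notation Zt := (noise ZB ZS).

Section ValueConditioning.
Variable V : T -> R.
Hypothesis iV : P.-integrable setT (EFin \o V).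

Definition value_set a : set T := v @^-1` [set a].

Definition value_mean a : R :=
  fine (\int[P]_(w in value_set a) (V w)%:E) / pr (value_set a).

Lemma value_set_sigma a : sigma_rv v (value_set a).
Proof. exact: sigma_rv_preimage. Qed.

Lemma value_set_measurable a : measurable (value_set a).
Proof. by apply: (value_sigma_measurable mkt); exact: value_set_sigma. Qed.

Lemma value_setC : value_set 1 = ~` value_set 0.
Proof.
apply/seteqP; split=> w; rewrite /value_set /=.
  by move=> -> /eqP; rewrite oner_eq0.
by case: (market_value mkt w).
Qed.

Lemma pr_value_set a : a = 0 \/ a = 1 -> 0 < pr (value_set a).
Proof.
have /andP[] := market_value_prob mkt; rewrite -/(value_set 0).
rewrite (prE P (value_set_measurable 0)) !lte_fin => h0 h1 [->//|->].
by rewrite value_setC pr_setC; [rewrite subr_gt0|exact: value_set_measurable].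
Qed.

Lemma value_mean_integral a : a = 0 \/ a = 1 ->
  (\int[P]_(w in value_set a) (value_mean (v w))%:E =
   \int[P]_(w in value_set a) (V w)%:E)%E.
Proof.
move=> a01; have mA := value_set_measurable a; have P0 := pr_value_set a01.
transitivity (\int[P]_(w in value_set a) (value_mean a)%:E)%E.
  by apply: eq_integral => w /set_mem ->.
have -> : (\int[P]_(w in value_set a) (value_mean a)%:E =
    (value_mean a)%:E * P (value_set a))%E by exact: integral_cst.
rewrite (prE P mA) -EFinM /value_mean divfK ?gt_eqF// fineK//.
by apply: integrable_fin_num => //; exact: integrableS iV.
Qed.

(** An event of sigma(v) contains each of the two atoms of [v] or misses it, and [value_mean] is the
    elementary conditional mean on an atom. *)
Lemma value_cond_exp : is_cond_exp P (sigma_rv v) V (value_mean \o v).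
Proof.
have g1 w : grid 1 (v w).
  by case: (market_value mkt w) => ->; [exists 0|exists 1]; rewrite ?mul0r ?mulr1.
have sW := grid_sigma (f := value_mean) g1.
have mW : measurable_fun setT (value_mean \o v).
  by apply/sigma_rv_measurable => B /sW; exact: value_sigma_measurable mkt _.
have iW : P.-integrable setT (EFin \o (value_mean \o v)).
  apply: (@bounded_integrable _ _ _ P _ (`|value_mean 0| + `|value_mean 1|)) => //.
  by move=> w; case: (market_value mkt w) => /= ->; rewrite ?lerDl ?lerDr.
split => // A vA; have mA := value_sigma_measurable mkt vA.
have [B mB AE] := vA.
have AvE a w : value_set a w -> A w = B a.
  by rewrite -AE setTI /value_set /preimage/= => ->.
have piece a : a = 0 \/ a = 1 ->
    (\int[P]_(w in A `&` value_set a) ((value_mean \o v) w)%:E =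
     \int[P]_(w in A `&` value_set a) (V w)%:E)%E.
  move=> a01; have [Ba|nBa] := pselect (B a).
    rewrite (_ : A `&` _ = value_set a); first exact: value_mean_integral.
    by apply/seteqP; split=> w; [case|move=> va; split => //; rewrite (AvE _ _ va)].
  rewrite (_ : A `&` _ = set0) ?integral_set0//.
  by apply/seteqP; split=> // w [+ va]; rewrite (AvE _ _ va).
have split_integral (f : T -> R) : measurable_fun setT f ->
    P.-integrable A (EFin \o f) -> (\int[P]_(w in A) (f w)%:E =
    \int[P]_(w in A `&` value_set 0) (f w)%:E +
    \int[P]_(w in A `&` value_set 1) (f w)%:E)%E.
  move=> mf iff; rewrite -{1}(setIT A) -(setvU (value_set 0)) setUC setIUr -value_setC.
  have m0 : measurable (A `&` value_set 0).
    by apply: measurableI => //; exact: value_set_measurable.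
  have m1 : measurable (A `&` value_set 1).
    by apply: measurableI => //; exact: value_set_measurable.
  rewrite (integral_setU P m0 m1)//.
  - by apply/measurable_EFinP; exact: measurable_funTS.
  - apply/disj_setPS => w [[_ w0] [_]]; rewrite value_setC; exact.
have mV : measurable_fun setT V by apply/measurable_EFinP; exact: measurable_int iV.
have iVA : P.-integrable A (EFin \o V) by exact: integrableS iV.
have iWA : P.-integrable A (EFin \o (value_mean \o v)) by exact: integrableS iW.
rewrite (split_integral _ mV iVA) (split_integral _ mW iWA).
by rewrite !piece; [|right|left].
Qed.

End ValueConditioning.

Variables (p : R -> R -> R) (z : R).
Hypotheses (gz : grid delta z) (pp : pricing_rule delta p).
Hypothesis pE : forall y t, grid delta y -> 0 <= t <= 1 ->
  p y t = bridge_price P ZB ZS z y t.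

Variables (XB XS : R -> T -> R) (FI : R -> set (set T)).
Hypothesis inc : inconspicuous P delta beta v ZB ZS XB XS FI.
Hypothesis zv :
  {ae P, forall w, (z <= total_demand ZB ZS XB XS 1 w) <-> (v w = 1)}.

Let bound w := potential delta z (v w) (Zt 1 w).

Lemma marked_profit_limit : {ae P, forall w,
  marked_profit v ZB ZS z XB XS n w @[n --> \oo] --> bound w}.
Proof.
have adm := inconspicuous_admissible inc.
have t11 : 0 <= (1 : R) <= 1 by rewrite ler01/=.
apply: filterS3 (inconspicuous_no_sell inc) (inconspicuous_no_buy inc) zv.
move=> w noS noB zvw.
have [pB pS] := admissible_path adm w.
have gZ : grid delta (Zt 1 w) by exact: (noise_grid delta0 mkt).
rewrite /total_demand in zvw; rewrite /bound.
have lim y : point_path delta y -> (forall t, 0 <= t <= 1 ->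
    XB t w - XS t w = (if v w == 1 then 1 else -1) * y t) ->
    marked_profit v ZB ZS z XB XS n w @[n --> \oo] --> potential delta z (v w) (Zt 1 w).
  move=> py xy.
  have := riemann_potential delta0 gz py (market_value mkt w) gZ xy.
  (* By [zv] demand ends on the side of z where the final potential vanishes. *)
  rewrite [X in _ - X](_ : _ = 0) ?subr0//.
  move: zvw; rewrite /potential; case: (market_value mkt w) => -> zvw.
    rewrite eq_sym oner_eq0; apply/max_idPr; rewrite subr_le0 leNgt.
    by apply/negP => /ltW /zvw /eqP; rewrite eq_sym oner_eq0.
  by rewrite eqxx; apply/max_idPr; have := zvw.2 erefl; have := delta0; lra.
case: (market_value mkt w) => vw.
  apply: (lim _ pS) => t t01; rewrite vw eq_sym oner_eq0.
  by rewrite (noB vw _ t01) sub0r mulN1r.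
by apply: (lim _ pB) => t t01; rewrite vw eqxx (noS vw _ t01) subr0 mul1r.
Qed.

(** Both sides are limits of the integrals of the same marked profits. *)
Lemma bound_integral A : sigma_rv v A -> P.-integrable A (EFin \o bound) /\
  (\int[P]_(w in A) (profit delta v ZB ZS p XB XS w)%:E =
   \int[P]_(w in A) (bound w)%:E)%E.
Proof.
move=> vA; have mA := value_sigma_measurable mkt vA.
have adm := inconspicuous_admissible inc.
have mb := ae_limit_measurable mkt
  (marked_profit_measurable delta0 mkt z adm) marked_profit_limit.
have [|||||ib _ lim] := @dominated_convergence _ _ _ P A mA
  (fun n w => (marked_profit v ZB ZS z XB XS n w)%:E) (EFin \o bound)
  (EFin \o (fun w => XB 1 w + XS 1 w)).
- move=> n; apply/measurable_EFinP/measurable_funTS.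
  exact: (marked_profit_measurable delta0 mkt z adm).
- exact/measurable_EFinP/measurable_funTS.
- by apply: filterS marked_profit_limit => w hw _; apply: cvg_EFin => //; exact: nearW.
- exact: (integrableS measurableT mA (@subsetT _ _) (volume_integrable adm)).
- apply: aeW => w n _ /=; rewrite lee_fin; exact: (marked_profit_bound mkt z adm).
split => //.
have [_ lim'] := profit_integral delta0 beta0 mkt pp pE adm vA.
exact: cvg_unique lim' lim.
Qed.

(** For every competitor the marked profits stay below [bound] at each n, and [bound] is what the
    inconspicuous strategy earns on average. *)
Lemma profit_integral_le XB' XS' FI' A :
  admissible P delta v ZB ZS XB' XS' FI' -> sigma_rv v A ->
  (\int[P]_(w in A) (profit delta v ZB ZS p XB' XS' w)%:E <=
   \int[P]_(w in A) (profit delta v ZB ZS p XB XS w)%:E)%E.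
Proof.
move=> adm vA; have mA := value_sigma_measurable mkt vA.
have [ib ->] := bound_integral vA.
have [_ lim] := profit_integral delta0 beta0 mkt pp pE adm vA.
rewrite -(cvg_lim _ lim)//; apply: lime_le; first by apply/cvg_ex; eexists; exact: lim.
apply: nearW => n; apply: le_integral => //.
  exact: (marked_profit_integrable delta0 mkt z adm).
move=> w _ /=; rewrite lee_fin; exact: (marked_profit_le delta0 mkt gz adm).
Qed.

(** Both values of [v] have positive probability, so comparing integrals over the two atoms compares
    the versions at every point. *)
Lemma inconspicuous_optimal : optimal_strategy P delta v ZB ZS p XB XS FI.
Proof.
have adm := inconspicuous_admissible inc; split => //.
have integ XB' XS' FI' A : admissible P delta v ZB ZS XB' XS' FI' -> sigma_rv v A ->
    P.-integrable A (EFin \o profit delta v ZB ZS p XB' XS').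
  by move=> adm' vA; have [] := profit_integral delta0 beta0 mkt pp pE adm' vA.
have vT : sigma_rv v setT by exact: value_setT.
exists (value_mean (profit delta v ZB ZS p XB XS) \o v).
  exact: value_cond_exp (integ _ _ _ _ adm vT).
move=> XB' XS' FI' adm'.
exists (value_mean (profit delta v ZB ZS p XB' XS') \o v).
  exact: value_cond_exp (integ _ _ _ _ adm' vT).
apply: aeW => w; rewrite /= /value_mean ler_pM2r; last first.
  by rewrite invr_gt0; apply: pr_value_set; exact: market_value mkt w.
have vA := value_set_sigma (v w).
apply: fine_le; last exact: profit_integral_le adm' vA.
  by apply: integrable_fin_num; [exact: value_set_measurable|exact: integ adm' vA].
by apply: integrable_fin_num; [exact: value_set_measurable|exact: integ adm vA].
Qed.

End Equilibrium.

Theorem theorem3p4 (R : realType) (d : measure_display) (T : measurableType d)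
  (P : probability T R) (FF : R -> set (set T)) (delta beta : R)
  (v : T -> R) (ZB ZS : R -> T -> R)
  (hdelta : 0 < delta) (hbeta : 0 < beta)
  (hmarket : market P delta beta v ZB ZS FF)
  (p : R -> R -> R)
  (hp : forall y t, grid delta y -> 0 <= t <= 1 -> 0 <= p y t <= 1)
  (XB XS : R -> T -> R) (FI : R -> set (set T)) :
  (exists ydelta : R,
    [/\ grid delta ydelta,
        {ae P, forall w, (ydelta <= total_demand ZB ZS XB XS 1 w) <-> (v w = 1)},
        (forall y t, grid delta y -> 0 <= t <= 1 ->
           p y t = bridge_price P ZB ZS ydelta y t) &
        inconspicuous P delta beta v ZB ZS XB XS FI]) ->
  GM_equilibrium P delta v ZB ZS p XB XS FI.
Proof.
move=> [z [gz zv pE inc]].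
have pp := bridge_pricing_rule hdelta hbeta hmarket gz hp pE.
split; first exact: (bridge_rational hdelta hbeta hmarket pp pE zv inc).
exact: (inconspicuous_optimal hdelta hbeta hmarket gz pp pE inc zv).
Qed.
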